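(* Let $(H,\top)$ be a graded, connected, cocommutative locality Hopf algebra. Then $H$ is generated by its primitive elements ${\rm Prim}(H)$ as a locality algebra. Assume moreover that the locality Lie algebra $\mathfrak g={\rm Prim}(H)$ satisfies: (a) for every $n\in\mathbb{N}$ the subspace $I^n_{\rm mult}(\mathfrak g)\cap F^n(\mathfrak g)\subset F^n(\mathfrak g)$ is locality compatible with $\top^n_\times$; (b) the ideal $J_\top(\mathfrak g)$ of $\mathcal{T}_\top(\mathfrak g)$ is locality compatible with $\top_\otimes$. Then there is an isomorphism of locality Hopf algebras $$(H,\top)\simeq(U_\top({\rm Prim}(H)),\top_U).$$
   Context: $\mathbb{K}$ is $\mathbb{R}$ or $\mathbb{C}$. A locality vector space is a vector space $V$ with a symmetric relation $\top\subset V\times V$ containing $(0,0)$ such that for every $U\subset V$ the polar set $U^\top=\{x: x\top u\ \forall u\in U\}$ is a linear subspace. Locality (linear) maps are (linear) maps sending related pairs to related pairs; maps $f,g:(X,\top_X)\to(Y,\top_Y)$ are mutually independent if $x\top_Xy$ implies $f(x)\top_Yg(y)$. A subspace $W$ of $(V,\top)$ is locality compatible with $\top$ if for all $x,y,z\in V$, $w\in W$ with $x\top y$ and $(x+w)\top z$, there is $w'\in W$ with $(x+w')\top y$ and $(x+w')\top z$. $\mathbb{K}(X)$ is the free vector space on $X$. Tensor algebra of $(V,\top)$: for $k\ge1$, $V^{\times_\top k}=\{(x_1,\dots,x_k)\in V^k: x_i\top x_j\ \forall i\ne j\}$; $I_{{\rm mult},k}(V)\subset\mathbb{K}(V^k)$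 is spanned by the multilinearity relations $(\dots,a_i+b_i,\dots)-(\dots,a_i,\dots)-(\dots,b_i,\dots)$ and $(\dots,cx_i,\dots)-c(\dots,x_i,\dots)$. $V^{\otimes_\top k}=\mathbb{K}(V^{\times_\top k})/(I_{{\rm mult},k}(V)\cap\mathbb{K}(V^{\times_\top k}))\subset V^{\otimes k}$, $V^{\otimes_\top0}=\mathbb{K}$, $\mathcal{T}_\top(V)=\bigoplus_kV^{\otimes_\top k}$. $F^n(V)=\mathbb{K}\cdot1\oplus\bigoplus_{k=1}^n\mathbb{K}(V^{\times_\top k})$, $I^n_{\rm mult}(V)=\bigoplus_{k=1}^nI_{{\rm mult},k}(V)$. Tuples $(x_i),(y_j)$ are $\top_\times^n$-related iff $x_i\top y_j$ for all $i,j$; $1$ is related to every basis element; two elements of $F^n(V)$ are related iff all basis elements with nonzero coefficient in the first are related to all those in the second. Elements of $\mathcal{T}_\top(V)$ are $\top_\otimes$-related iff for some $n$ they have related representatives in $F^n(V)$. The product is the tensor product restricted to $\top_\otimes$. For subspaces $U_1,U_2\subset V$, $U_1\otimes_\top U_2\subset V\otimes_\top V$ is spanned by $x\otimes y$, $x\in U_1,y\in U_2,x\top y$. Algebras: a map on $A\times_\top A:=\top$ is $\top_\times$-bilinear if its linear extension to $\mathbb{K}(\top)$ vanishes on $I_{{\rm mult},2}(A)\cap\mathbb{K}(\top)$. A locality algebra $(A,\top,m,u)$ is a locality vector space with a $\top_\times$-bilinear $m:\top\to A$, associative on pairwise independent triples whenever both sides are defined, with $m((U^\top\times U^\top)\cap\top)\subset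 U^\top$ for all $U\subset A$, and a linear unit $u:\mathbb{K}\to A$ with $u(\mathbb{K})\subset A^\top$, $m(u(c),a)=ca=m(a,u(c))$. A locality algebra morphism is a locality linear map compatible with products of related pairs and with units. A (pre-)locality ideal is a subspace $I$ with $m(I\times I^\top),m(I^\top\times I)\subset I$. Hopf algebras: a locality coalgebra $(C,\Delta,\epsilon,\top)$ is a locality vector space with linear maps $\Delta:C\to C\otimes_\top C$, $\epsilon:C\to\mathbb{K}$ such that $\Delta$ is coassociative, $\Delta(U^\top)\subset U^\top\otimes_\top U^\top$ for all $U\subset C$, and $(\epsilon\otimes{\rm Id})\Delta={\rm Id}=({\rm Id}\otimes\epsilon)\Delta$. A locality coalgebra morphism is a locality linear map $f$ with $(f\otimes f)\Delta_1=\Delta_2f$ and $\epsilon_1=\epsilon_2f$. A locality bialgebra is both a locality algebra and a locality coalgebra such that $\Delta,\epsilon$ are locality algebra morphisms and $m,u$ locality coalgebra morphisms: $\Delta(xy)=\sum x_1y_1\otimes x_2y_2$ and $\epsilon(xy)=\epsilon(x)\epsilon(y)$ for $x\top y$, $\Delta(1)=1\otimes1$, $\epsilon(1)=1$. A locality Hopf algebra is a locality bialgebra with a locality linear map $S$, mutually independent of ${\rm Id}$, with $m(S\otimes{\rm Id})\Delta=m({\rm Id}\otimes S)\Delta=u\circ\epsilon$. A locality Hopf algebra morphism is a locality algebra and coalgebra morphism commuting with antipodes; an isomorphism is an invertible one whose inverse is also a morphism. $H$ is graded if $H=\bigoplus_{n\ge0}H_n$ with $m(H_p\otimes_\top H_q)\subset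 H_{p+q}$, $u(\mathbb{K})\subset H_0$, $\Delta(H_n)\subset\bigoplus_{p+q=n}H_p\otimes_\top H_q$, $\bigoplus_{n\ge1}H_n\subset\ker\epsilon$, $S(H_n)\subset H_n$; connected if $\dim H_0=1$; cocommutative if $\Delta$ is invariant under exchanging the two tensor factors. ${\rm Prim}(H)=\{x:\Delta x=x\otimes1+1\otimes x\}$ with the restriction of $\top$ and bracket $[x,y]=xy-yx$ for $x\top y$ is a locality Lie algebra, i.e. a locality vector space $(\mathfrak g,\top)$ with an antisymmetric $\top_\times$-bilinear bracket $[\,,]:\top\to\mathfrak g$ that is locality (if $(a,b),(a',b')\in\top$, $a\top a'$ and $b\top b'$, then $[a,b]\top[a',b']$), maps $(U^\top\times U^\top)\cap\top$ into $U^\top$, and satisfies Jacobi for pairwise independent triples. For a locality Lie algebra $\mathfrak g$, $J_\top(\mathfrak g)$ is the (pre-)locality ideal of $\mathcal{T}_\top(\mathfrak g)$ generated by all $a\otimes b-b\otimes a-[a,b]$, $a\top b$; $U_\top(\mathfrak g)=\mathcal{T}_\top(\mathfrak g)/J_\top(\mathfrak g)$; $x\top_Uy$ iff there are representatives $a\in x,b\in y$ with $a\top_\otimes b$. With $\iota_{\mathfrak g}:\mathfrak g\to U_\top(\mathfrak g)$ canonical, $U_\top(\mathfrak g)$ is a locality Hopf algebra for the locality algebra morphism $\Delta$ extending $x\mapsto\iota_{\mathfrak g}(x)\otimes1+1\otimes\iota_{\mathfrak g}(x)$, the counit being the algebra morphism vanishing on $\iota_{\mathfrak g}(\mathfrak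 g)$, and the antipode extending $x\mapsto-\iota_{\mathfrak g}(x)$. ''Generated as a locality algebra'' means that the locality subalgebra generated by ${\rm Prim}(H)\cup\{1\}$ is all of $H$.
   Formalization: A (pre-)locality ideal I is read elementwise: x in I and x ⊤ a imply xa, ax in I, and J_⊤(g) is the smallest such ideal; with m(I×I^⊤), m(I^⊤×I) ⊂ I for the polar of the whole set I, the claim fails. *)

(* Defs.v *)
From HB Require Import structures.
From mathcomp Require Import all_boot all_order all_algebra.
From mathcomp Require Import boolp classical_sets reals.
From mathcomp Require Import complex finmap.
From mathcomp.multinomials Require Import monalg.

Set Implicit Arguments.
Unset Strict Implicit.
Unset Printing Implicit Defensive.

Import GRing.Theory.
Local Open Scope classical_set_scope.
Local Open Scope ring_scope.
Local Open Scope quotient_scope.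
Import Quotient.

Variant real_or_complex (R : realType) : fieldType -> Prop :=
| Scalars_real : real_or_complex R R
| Scalars_complex : real_or_complex R R[i].

Section LinearAlgebra.
Variables (K : fieldType) (V : lmodType K).

Definition subspace (S : set V) : Prop :=
  S 0 /\ forall c x y, S x -> S y -> S (c *: x + y).

Inductive span (S : set V) : set V :=
| span0 : span S 0
| spanD c x y : S x -> span S y -> span S (c *: x + y).

Lemma span_subspace (S : set V) : subspace (span S).
Proof.
split=> [|c x y]; first exact: span0.
move=> Sx Sy; elim: Sx => [|d u v Su Sv IH]; first by rewrite scaler0 add0r.
by rewrite scalerDr scalerA -addrA; apply: spanD.
Qed.

Definition in_span (S : set V) (x : V) : bool := `[< span S x >].

Lemma in_span_submod (S : set V) : submod_closed (in_span S).
Proof.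
split; first by apply/asboolP; exact: span0.
by move=> c x y /asboolP hx /asboolP hy; apply/asboolP; apply (span_subspace S).2.
Qed.

HB.instance Definition _ (S : set V) :=
  GRing.isSubmodClosed.Build K V (in_span S) (in_span_submod S).

(* The quotient space V / span S. *)
Definition vquot (S : set V) : Type := {quot (GRing.SubmodClosed.clone K V (in_span S) _)}.

Variable S : set V.
HB.instance Definition _ := GRing.Zmodule.on (vquot S).
HB.instance Definition _ :=
  EqQuotient.copy (vquot S) ({quot (GRing.SubmodClosed.clone K V (in_span S) _)}).

Definition vproj_fun (x : V) : vquot S := \pi_(vquot S) x.

Lemma vprojP x y : vproj_fun x = vproj_fun y <-> span S (x - y).
Proof.
split=> [/eqP|h].
  by rewrite /vproj_fun -Quotient.idealrBE => /asboolP.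
by apply/eqP; rewrite /vproj_fun -Quotient.idealrBE; apply/asboolP.
Qed.

Lemma vproj_repr (x : vquot S) : vproj_fun (repr x) = x.
Proof. exact: reprK. Qed.

Lemma vproj_additive : additive vproj_fun.
Proof.
move=> x y; rewrite /vproj_fun.
exact: (raddfB (\pi_({quot (GRing.SubmodClosed.clone K V (in_span S) _)}))).
Qed.
HB.instance Definition _ :=
  GRing.isZmodMorphism.Build V (vquot S) vproj_fun vproj_additive.

Lemma vprojD x y : vproj_fun (x + y) = vproj_fun x + vproj_fun y.
Proof. exact: raddfD. Qed.

Definition vscale (c : K) (x : vquot S) : vquot S := vproj_fun (c *: repr x).

Lemma vscaleE c x : vscale c (vproj_fun x) = vproj_fun (c *: x).
Proof.
rewrite /vscale; apply/vprojP; rewrite -scalerBr -[X in span _ X]addr0.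
apply (span_subspace S).2; last exact: span0.
by apply/vprojP; rewrite vproj_repr.
Qed.

Lemma vscaleA a b v : vscale a (vscale b v) = vscale (a * b) v.
Proof. by rewrite -[v]vproj_repr !vscaleE scalerA. Qed.
Lemma vscale1 : left_id 1 vscale.
Proof. by move=> v; rewrite -[v]vproj_repr !vscaleE scale1r. Qed.
Lemma vscaleDr : right_distributive vscale +%R.
Proof.
move=> a u v; rewrite -[u]vproj_repr -[v]vproj_repr !vscaleE.
by rewrite -!vprojD vscaleE scalerDr.
Qed.
Lemma vscaleDl v : {morph vscale^~ v : a b / a + b}.
Proof.
by move=> a b; rewrite -[v]vproj_repr !vscaleE scalerDl vprojD.
Qed.
HB.instance Definition _ := GRing.Zmodule_isLmodule.Build K (vquot S)
  vscaleA vscale1 vscaleDr vscaleDl.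

Lemma vproj_scalable : scalable vproj_fun.
Proof. by move=> c x; rewrite -vscaleE. Qed.
HB.instance Definition _ :=
  GRing.isScalable.Build K V (vquot S) *:%R vproj_fun vproj_scalable.
Definition vproj : {linear V -> vquot S} := vproj_fun.

End LinearAlgebra.
Arguments vproj {K V} S.

Section FreeSpace.
Variables (K : fieldType) (X : choiceType) (W : lmodType K).

(* {malg K[X]} is the free vector space on X; lext f is the linear extension
   of f : X -> W. *)
Definition lext (f : X -> W) (x : {malg K[X]}) : W :=
  \sum_(p <- msupp x) x@_p *: f p.

Lemma lextEw (f : X -> W) (x : {malg K[X]}) (D : {fset X}) :
  (msupp x `<=` D)%fset -> lext f x = \sum_(p <- D) x@_p *: f p.
Proof.
move=> sxD; rewrite /lext [RHS](bigID (mem (msupp x))) /=.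
rewrite [X in _ + X]big1 ?addr0; last first.
  by move=> p px; rewrite mcoeff_outdom // scale0r.
by rewrite -[RHS]big_filter; apply: perm_big; apply: uniq_perm;
  rewrite ?filter_uniq ?fset_uniq // => p; rewrite mem_filter;
  case: (boolP (p \in msupp x)) => //= /(fsubsetP sxD) ->.
Qed.

Lemma lext_linear (f : X -> W) : linear (lext f).
Proof.
move=> c x y; pose D := (msupp (c *: x + y) `|` (msupp x `|` msupp y))%fset.
have s1 : (msupp (c *: x + y) `<=` D)%fset by rewrite fsubsetUl.
have s2 : (msupp x `<=` D)%fset by rewrite /D fsetUCA fsubsetUl.
have s3 : (msupp y `<=` D)%fset by rewrite /D fsetUA fsubsetUr.
rewrite (lextEw f s1) (lextEw f s2) (lextEw f s3).
rewrite scaler_sumr -big_split; apply: eq_bigr => p _ /=.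
by rewrite mcoeffD mcoeffZ scalerDl scalerA.
Qed.
HB.instance Definition _ (f : X -> W) :=
  GRing.isLinear.Build K {malg K[X]} W *:%R (lext f) (lext_linear f).

Lemma lextU (f : X -> W) p : lext f << p >> = f p.
Proof.
rewrite (@lextEw f _ [fset p]%fset) ?msuppU_le //.
by rewrite big_seq_fset1 mcoeffUU scale1r.
Qed.

End FreeSpace.

Section Tensor.
Variables (K : fieldType) (U V : lmodType K).

(* These relations span the subspace I_{mult,2} of K(U x V). *)
Inductive bilinear_relation : set {malg K[(U * V)%type]} :=
| BilDl a b v : bilinear_relation (<< (a + b, v) >> - << (a, v) >> - << (b, v) >>)
| BilDr u a b : bilinear_relation (<< (u, a + b) >> - << (u, a) >> - << (u, b) >>)
| BilZl c u v : bilinear_relation (<< (c *: u, v) >> - c *: << (u, v) >>)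
| BilZr c u v : bilinear_relation (<< (u, c *: v) >> - c *: << (u, v) >>).

Definition tensor : Type := vquot bilinear_relation.
HB.instance Definition _ := GRing.Lmodule.on tensor.

(* The class in the tensor product of an element of K(U x V). *)
Definition tclass : {linear {malg K[(U * V)%type]} -> tensor} := vproj bilinear_relation.

Definition tens (u : U) (v : V) : tensor := tclass << (u, v) >>.

Lemma tclassP X Y : tclass X = tclass Y <-> span bilinear_relation (X - Y).
Proof. exact: vprojP. Qed.

Lemma tensDl a b v : tens (a + b) v = tens a v + tens b v.
Proof.
rewrite /tens -raddfD; apply/tclassP; rewrite opprD addrA.
rewrite -[X in span _ X]addr0 -[X in span _ (X + _)]scale1r.
by apply: spanD (span0 _); exact: BilDl.
Qed.

Lemma tensDr u a b : tens u (a + b) = tens u a + tens u b.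
Proof.
rewrite /tens -raddfD; apply/tclassP; rewrite opprD addrA.
rewrite -[X in span _ X]addr0 -[X in span _ (X + _)]scale1r.
by apply: spanD (span0 _); exact: BilDr.
Qed.

Lemma tensZl c u v : tens (c *: u) v = c *: tens u v.
Proof.
rewrite /tens -linearZ; apply/tclassP.
rewrite -[X in span _ X]addr0 -[X in span _ (X + _)]scale1r.
by apply: spanD (span0 _); exact: BilZl.
Qed.

Lemma tensZr c u v : tens u (c *: v) = c *: tens u v.
Proof.
rewrite /tens -linearZ; apply/tclassP.
rewrite -[X in span _ X]addr0 -[X in span _ (X + _)]scale1r.
by apply: spanD (span0 _); exact: BilZr.
Qed.

Definition bilinear_map (W : lmodType K) (f : U -> V -> W) : Prop :=
  (forall v, linear (f^~ v)) /\ (forall u, linear (f u)).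

(* The map induced by f on the tensor product.  It is the linear map given by
   the universal property when f is bilinear (tliftE); otherwise it depends on
   the choice of representatives made by repr. *)
Definition tlift (W : lmodType K) (f : U -> V -> W) (t : tensor) : W :=
  lext (fun p => f p.1 p.2) (repr t).

Lemma tliftE (W : lmodType K) (f : U -> V -> W) X : bilinear_map f ->
  tlift f (tclass X) = lext (fun p => f p.1 p.2) X.
Proof.
move=> [fl fr]; apply/eqP; rewrite -subr_eq0 -raddfB /=; apply/eqP.
have : span bilinear_relation (repr (tclass X) - X).
  by apply/tclassP; exact: (vproj_repr (tclass X)).
elim=> [|c x y rx _ IH]; first by rewrite raddf0.
rewrite lext_linear IH addr0.
suff -> : lext (fun p => f p.1 p.2) x = 0 by rewrite scaler0.
have fDl a b v : f (a + b) v = f a v + f b v.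
  by have := fl v 1 a b; rewrite !scale1r.
have fDr u a b : f u (a + b) = f u a + f u b.
  by have := fr u 1 a b; rewrite !scale1r.
have f0l v : f 0 v = 0 by apply: (addIr (f 0 v)); rewrite -fDl !add0r.
have f0r u : f u 0 = 0 by apply: (addIr (f u 0)); rewrite -fDr !add0r.
case: rx => [a b v|u a b|d u v|d u v]; rewrite !raddfB /= ?linearZ_LR /= !lextU /=.
- by rewrite fDl -addrA -opprD subrr.
- by rewrite fDr -addrA -opprD subrr.
- by have := fl v d u 0; rewrite addr0 f0l addr0 => ->; rewrite scalerN subrr.
- by have := fr u d v 0; rewrite addr0 f0r addr0 => ->; rewrite scalerN subrr.
Qed.

End Tensor.
Arguments tclass {K U V}.

Section LocalitySpace.
Variables (K : fieldType) (V : lmodType K).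
Implicit Types (T : rel V) (U E W : set V) (m : V -> V -> V).

Definition polar T U : set V := [set x | forall u, U u -> T x u].

Definition locality_space T : Prop :=
  [/\ symmetric T, T 0 0 & forall U, subspace (polar T U)].

(* The subspace W of E is locality compatible with the relation T on E, where
   E is itself given as a subspace of V. *)
Definition locality_compatible E T W : Prop :=
  forall x y z w, E x -> E y -> E z -> W w -> T x y -> T (x + w) z ->
  exists w', [/\ W w', T (x + w') y & T (x + w') z].

Definition on_relation T (X : {malg K[(V * V)%type]}) : Prop :=
  forall p, p \in msupp X -> T p.1 p.2.

(* A partial map m : T -> V is represented by a total one, of which only the
   values at related pairs are ever constrained or used. *)
Definition locality_bilinear T m : Prop :=
  forall X, on_relation T X -> span (@bilinear_relation K V V) X ->
  lext (fun p => m p.1 p.2) X = 0.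

Definition locality_tensor T U1 U2 : set (tensor V V) :=
  span [set t | exists x y, [/\ U1 x, U2 y, T x y & t = tens x y]].

Definition pairs_independent T (X Y : {malg K[(V * V)%type]}) : Prop :=
  forall p q, p \in msupp X -> q \in msupp Y ->
  [/\ T p.1 q.1, T p.1 q.2, T p.2 q.1 & T p.2 q.2].

(* Independence is required of x alone, not of the whole of I: products with
   everything independent of an element of I are what the product of a quotient
   needs, and this closure condition is stable under intersections, so that the
   ideal generated by a set exists. *)
Definition locality_ideal T m (I : set V) : Prop :=
  subspace I /\ forall x a, I x -> T x a -> I (m x a) /\ I (m a x).

Definition locality_ideal_generated T m (S : set V) : set V :=
  [set x | forall I, locality_ideal T m I -> S `<=` I -> I x].

Definition locality_subalgebra T m (e : V) (B : set V) : Prop :=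
  [/\ subspace B, B e & forall x y, B x -> B y -> T x y -> B (m x y)].

Definition locality_subalgebra_generated T m (e : V) (S : set V) : set V :=
  [set x | forall B, locality_subalgebra T m e B -> S `<=` B -> B x].

End LocalitySpace.

Section TensorMaps.
Variables (K : fieldType).

Definition tmap (U V U' V' : lmodType K) (f : U -> U') (g : V -> V') :
    tensor U V -> tensor U' V' :=
  tlift (fun u v => tens (f u) (g v)).

Definition tassoc (U V W : lmodType K) :
    tensor (tensor U V) W -> tensor U (tensor V W) :=
  tlift (fun t w => tlift (fun u v => tens u (tens v w)) t).

Definition tswap (U V : lmodType K) : tensor U V -> tensor V U :=
  tlift (fun u v => tens v u).

End TensorMaps.

Section LocalityHopf.
Variables (K : fieldType).

(* The unit map u is c |-> c *: lone. *)
Record hopf_ops (V : lmodType K) := HopfOps {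
  ltop : rel V;
  lmul : V -> V -> V;
  lone : V;
  lcop : {linear V -> tensor V V};
  lcounit : {linear V -> K^o};
  lantip : {linear V -> V} }.

Variables (V : lmodType K).

Record is_locality_algebra (T : rel V) (m : V -> V -> V) (e : V) : Prop := {
  alg_space : locality_space T;
  alg_bilinear : locality_bilinear T m;
  alg_assoc : forall a b c, T a b -> T a c -> T b c ->
    T (m a b) c -> T a (m b c) -> m (m a b) c = m a (m b c);
  alg_polar : forall U a b, polar T U a -> polar T U b -> T a b ->
    polar T U (m a b);
  alg_unit_polar : forall c a, T (c *: e) a;
  alg_unitl : forall c a, m (c *: e) a = c *: a;
  alg_unitr : forall c a, m a (c *: e) = c *: a }.

Record is_locality_coalgebra (T : rel V) (D : {linear V -> tensor V V})
    (eps : {linear V -> K^o}) : Prop := {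
  coalg_space : locality_space T;
  coalg_tensor : forall x, locality_tensor T setT setT (D x);
  coalg_assoc : forall x, tassoc (tmap D id (D x)) = tmap id D (D x);
  coalg_polar : forall U x, polar T U x ->
    locality_tensor T (polar T U) (polar T U) (D x);
  coalg_counitl : forall x, tlift (fun a b => eps a *: b) (D x) = x;
  coalg_counitr : forall x, tlift (fun a b => eps b *: a) (D x) = x }.

(* In bialg_copM, X and Y are related representatives of the coproducts of x
   and y, so that all the products on the right-hand side are defined.  For
   related x and y such representatives exist by coalg_polar, and the
   right-hand side does not depend on them by alg_bilinear. *)
Record is_locality_bialgebra (h : hopf_ops V) : Prop := {
  bialg_alg : is_locality_algebra (ltop h) (lmul h) (lone h);
  bialg_coalg : is_locality_coalgebra (ltop h) (lcop h) (lcounit h);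
  bialg_copM : forall x y X Y, ltop h x y ->
    on_relation (ltop h) X -> on_relation (ltop h) Y ->
    pairs_independent (ltop h) X Y ->
    tclass X = lcop h x -> tclass Y = lcop h y ->
    lcop h (lmul h x y) =
    lext (fun p => lext (fun q =>
      tens (lmul h p.1 q.1) (lmul h p.2 q.2)) Y) X;
  bialg_counitM : forall x y, ltop h x y ->
    lcounit h (lmul h x y) = (lcounit h x : K) * (lcounit h y : K);
  bialg_cop1 : lcop h (lone h) = tens (lone h) (lone h);
  bialg_counit1 : lcounit h (lone h) = 1 }.

(* Likewise, the antipode identities are stated on an arbitrary representative
   X of the coproduct of x whose pairs are independent. *)
Record is_locality_hopf (h : hopf_ops V) : Prop := {
  hopf_bialg : is_locality_bialgebra h;
  hopf_antip_locality : forall x y, ltop h x y ->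
    ltop h (lantip h x) (lantip h y);
  hopf_antip_independent : forall x y, ltop h x y -> ltop h (lantip h x) y;
  hopf_antipl : forall x X, on_relation (ltop h) X -> tclass X = lcop h x ->
    lext (fun p => lmul h (lantip h p.1) p.2) X =
    (lcounit h x : K) *: lone h;
  hopf_antipr : forall x X, on_relation (ltop h) X -> tclass X = lcop h x ->
    lext (fun p => lmul h p.1 (lantip h p.2)) X =
    (lcounit h x : K) *: lone h }.

Variable h : hopf_ops V.

Record is_hopf_grading (G : nat -> set V) : Prop := {
  grading_subspace : forall n, subspace (G n);
  grading_sum : forall x, exists N f,
    (forall n, G n (f n)) /\ x = \sum_(n < N) f n;
  grading_direct : forall N f, (forall n, G n (f n)) ->
    \sum_(n < N) f n = 0 -> forall n, (n < N)%N -> f n = 0;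
  grading_mul : forall p q x y, G p x -> G q y -> ltop h x y ->
    G (p + q)%N (lmul h x y);
  grading_one : G 0%N (lone h);
  grading_cop : forall n x, G n x ->
    span [set t | exists p q,
      (p + q = n)%N /\ locality_tensor (ltop h) (G p) (G q) t] (lcop h x);
  grading_counit : forall n x, (0 < n)%N -> G n x -> lcounit h x = 0;
  grading_antip : forall n x, G n x -> G n (lantip h x) }.

Definition connected_grading (G : nat -> set V) : Prop :=
  exists e, e != 0 /\ forall x, G 0%N x <-> exists c : K, x = c *: e.

Definition cocommutative : Prop := forall x, tswap (lcop h x) = lcop h x.

Definition primitive : {pred V} :=
  fun x => lcop h x == tens x (lone h) + tens (lone h) x.

Definition generated_by_primitives : Prop :=
  locality_subalgebra_generated (ltop h) (lmul h) (lone h)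
    ([set x | x \in primitive] `|` [set lone h]) = setT.

Lemma primitive_submod : submod_closed primitive.
Proof.
have P c x y : x \in primitive -> y \in primitive ->
    c *: x + y \in primitive.
  rewrite !unfold_in => /eqP hx /eqP hy; apply/eqP; rewrite linearP hx hy.
  by rewrite tensDl tensDr tensZl tensZr scalerDr addrACA.
split=> [|c x y]; last exact: P.
rewrite unfold_in linear0; apply/eqP; rewrite -(scale0r (lone h)).
by rewrite tensZl tensZr !scale0r addr0.
Qed.
HB.instance Definition _ :=
  GRing.isSubmodClosed.Build K V primitive primitive_submod.

Record prim : predArgType := Prim { prim_val : V; _ : prim_val \in primitive }.
HB.instance Definition _ := [isSub for prim_val].
HB.instance Definition _ := [Choice of prim by <:].
HB.instance Definition _ := [SubChoice_isSubLmodule of prim by <:].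

Definition prim_top : rel prim := fun x y => ltop h (prim_val x) (prim_val y).

(* insubd casts xy - yx to the type of primitive elements, to which it belongs
   whenever x and y are related (prim_bracketE). *)
Definition prim_bracket (x y : prim) : prim :=
  insubd 0 (lmul h (prim_val x) (prim_val y) - lmul h (prim_val y) (prim_val x)).

Lemma subr_exchange (Z : zmodType) (a b c d e f : Z) :
  a + b + (c + d) - (e + c + (b + f)) = a - e + (d - f).
Proof.
rewrite [c + d]addrC [b + f]addrC (addrACA a) (addrACA e) [c + b]addrC.
by rewrite opprD (addrACA (a + d)) subrr addr0 opprD addrACA.
Qed.

Lemma prim_bracketE (x y : prim) : is_locality_hopf h -> prim_top x y ->
  prim_val (prim_bracket x y) =
  lmul h (prim_val x) (prim_val y) - lmul h (prim_val y) (prim_val x).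
Proof.
case: x y => [x px] [y py] [[A C copM _ _ _] _ _ _ _]; rewrite /prim_top /= => xy.
have [symT _ _] := alg_space A.
have eT a : ltop h (lone h) a.
  by have := alg_unit_polar A 1 a; rewrite scale1r.
have Te a : ltop h a (lone h) by rewrite symT eT.
have e1 a : lmul h (lone h) a = a.
  by have := alg_unitl A 1 a; rewrite !scale1r.
have m1 a : lmul h a (lone h) = a.
  by have := alg_unitr A 1 a; rewrite !scale1r.
pose X z : {malg K[(V * V)%type]} := << (z, lone h) >> + << (lone h, z) >>.
have sX z p : p \in msupp (X z) -> p = (z, lone h) \/ p = (lone h, z).
  move=> /(fsubsetP (msuppD_le _ _)); rewrite in_fsetU.
  by case/orP=> /(fsubsetP msuppU_le); rewrite in_fset1 => /eqP ->; [left|right].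
have onX z : on_relation (ltop h) (X z) by move=> p /sX [] -> /=.
have cX z : z \in primitive -> tclass (X z) = lcop h z.
  by rewrite unfold_in => /eqP ->; rewrite raddfD.
have copE a b : a \in primitive -> b \in primitive -> ltop h a b ->
    lcop h (lmul h a b) = tens (lmul h a b) (lone h) + tens a b
      + (tens b a + tens (lone h) (lmul h a b)).
  move=> pa pb ab; rewrite (copM a b (X a) (X b)) ?cX //.
    by rewrite /X !raddfD /= !lextU /= !raddfD /= !lextU /= !m1 !e1.
  by move=> p q /sX [] -> /sX [] -> /=; split; rewrite ?eT ?Te ?ab.
have pxy : lmul h x y - lmul h y x \in primitive.
  have yx : ltop h y x by rewrite symT.
  rewrite unfold_in; apply/eqP.
  have tBl a b c : tens (a - b) c = tens a c - tens b c :> tensor V V.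
    by rewrite -scaleN1r tensDl tensZl scaleN1r.
  have tBr a b c : tens c (a - b) = tens c a - tens c b :> tensor V V.
    by rewrite -scaleN1r tensDr tensZr scaleN1r.
  rewrite (linearB (lcop h)) (copE _ _ px py xy) (copE _ _ py px yx) tBl tBr.
  exact: subr_exchange.
by rewrite /prim_bracket /= -[prim_val _]/(val _) insubdK.
Qed.

End LocalityHopf.

Section InducedStructure.
Variables (K : fieldType) (V W : lmodType K) (q : V -> W).

(* The relation and the partial product induced on the quotient W of V by
   related representatives. *)
Definition induced_rel (T : rel V) : rel W := fun x y =>
  `[< exists a b, [/\ q a = x, q b = y & T a b] >].

Definition induced_mul (T : rel V) (m : V -> V -> V) : W -> W -> W := fun x y =>
  let r := xget (0, 0) [set r : V * V | [/\ q r.1 = x, q r.2 = y & T r.1 r.2]] in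
  q (m r.1 r.2).

End InducedStructure.

Section TensorAlgebra.
Variables (K : fieldType) (g : lmodType K) (T : rel g).

(* The words with pairwise independent letters.  The direct sum of the spaces
   K(g^k) is K(seq g), and that of the K(g^{x_T k}) is K(lword), where the
   basis element 1 is the empty word. *)
Definition lword : Type := {s : seq g | pairwise T s}.
HB.instance Definition _ := Choice.on lword.

(* lw is only applied to words with pairwise independent letters. *)
Definition lw (s : seq g) : lword := insubd (exist _ [::] isT) s.

Definition word_space : lmodType K := {malg K[lword]}.

Definition word_incl : word_space -> {malg K[seq g]} :=
  lext (fun s : lword => << val s >>).

Inductive mult_relation (n : nat) : set {malg K[seq g]} :=
| MultD s t a b : (size s + size t < n)%N -> mult_relation n
    (<< s ++ (a + b) :: t >> - << s ++ a :: t >> - << s ++ b :: t >>)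
| MultZ s t c a : (size s + size t < n)%N -> mult_relation n
    (<< s ++ (c *: a) :: t >> - c *: << s ++ a :: t >>).

(* I^n_mult, F^n and I^n_mult :&: F^n; word_top restricts to the relation
   T^n_x on F^n. *)
Definition Imult n : set {malg K[seq g]} := span (mult_relation n).
Definition Fword n : set word_space :=
  [set X | forall s, s \in msupp (X : {malg K[lword]}) -> (size (val s) <= n)%N].
Definition Imult_local n : set word_space :=
  [set X | Fword n X /\ Imult n (word_incl X)].

Definition word_top : rel word_space := fun X Y =>
  allrel (fun s t : lword => allrel T (val s) (val t))
    (msupp (X : {malg K[lword]})) (msupp (Y : {malg K[lword]})).

Definition word_mul (X Y : word_space) : word_space :=
  lext (fun s : lword =>
    lext (fun t : lword => << lw (val s ++ val t) >> : word_space) Y) X.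

Definition tens_alg : lmodType K := vquot (\bigcup_n Imult_local n).
Definition tens_proj : {linear word_space -> tens_alg} :=
  vproj (\bigcup_n Imult_local n).

Definition tens_top : rel tens_alg := induced_rel tens_proj word_top.
Definition tens_mul := induced_mul tens_proj word_top word_mul.
Definition tens_word (s : seq g) : tens_alg := tens_proj << lw s >>.

Variable br : g -> g -> g.

Definition Jideal : set tens_alg := locality_ideal_generated tens_top tens_mul
  [set r | exists a b, T a b /\
    r = tens_word [:: a; b] - tens_word [:: b; a] - tens_word [:: br a b]].

Definition envelope : lmodType K := vquot Jideal.
Definition env_proj : {linear tens_alg -> envelope} := vproj Jideal.

Definition env_top : rel envelope := induced_rel env_proj tens_top.
Definition env_mul := induced_mul env_proj tens_top tens_mul.
Definition env_one : envelope := env_proj (tens_word [::]).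
Definition env_iota (x : g) : envelope := env_proj (tens_word [:: x]).

Definition env_ops (D : {linear envelope -> tensor envelope envelope})
    (eps : {linear envelope -> K^o}) (S : {linear envelope -> envelope}) :
    hopf_ops envelope :=
  HopfOps env_top env_mul env_one D eps S.

Record is_envelope_hopf D eps S : Prop := {
  envelope_hopf : is_locality_hopf (env_ops D eps S);
  envelope_cop : forall x, D (env_iota x) =
    tens (env_iota x) env_one + tens env_one (env_iota x);
  envelope_counit : forall x, eps (env_iota x) = 0;
  envelope_antip : forall x, S (env_iota x) = - env_iota x }.

End TensorAlgebra.

Section HopfMorphism.
Variables (K : fieldType).

Record is_hopf_morphism (V W : lmodType K) (hV : hopf_ops V) (hW : hopf_ops W)
    (f : {linear V -> W}) : Prop := {
  morph_top : forall x y, ltop hV x y -> ltop hW (f x) (f y);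
  morph_mul : forall x y, ltop hV x y ->
    f (lmul hV x y) = lmul hW (f x) (f y);
  morph_one : f (lone hV) = lone hW;
  morph_cop : forall x, tmap f f (lcop hV x) = lcop hW (f x);
  morph_counit : forall x, lcounit hW (f x) = lcounit hV x;
  morph_antip : forall x, f (lantip hV x) = lantip hW (f x) }.

Definition hopf_isomorphic (V W : lmodType K) (hV : hopf_ops V)
    (hW : hopf_ops W) : Prop :=
  exists (f : {linear V -> W}) (f' : {linear W -> V}),
  [/\ cancel f f', cancel f' f,
      is_hopf_morphism hV hW f & is_hopf_morphism hW hV f'].

End HopfMorphism.

Arguments Fword {K g} T n _.
Arguments word_top {K g} T _ _.
Arguments Imult_local {K g} T n _.
Arguments tens_top {K g} T _ _.
Arguments Jideal {K g} T br _.
Arguments prim_top {K V} h _ _.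
Arguments prim_bracket {K V} h _ _.
Arguments env_ops {K g} T br D eps S.
Arguments is_envelope_hopf {K g} T br D eps S.

(* Main.v *)
From HB Require Import structures.
From mathcomp Require Import all_boot all_order all_algebra.
From mathcomp Require Import boolp classical_sets reals.
From mathcomp Require Import complex finmap.
From mathcomp.multinomials Require Import monalg.
Require Import Defs.

Set Implicit Arguments.
Unset Strict Implicit.
Unset Printing Implicit Defensive.

Import GRing.Theory.
Local Open Scope classical_set_scope.
Local Open Scope ring_scope.

(** Write T for the independence relation.  That x T y says nothing about the
    homogeneous components of x and y, so primitive elements are produced by
    convolution operators, which do respect T.

    Total products.  The partial product of H is linear on the span of the
    tensors of independent pairs, hence extends to a linear map mu on the whole
    of the tensor square (linear_extension, locality_product).  All identities
    are then between everywhere defined linear maps, and independence serves only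
    to know where mu is the given product and where it is associative.  A linear
    map f such that x T y implies f x T y preserves all polars, and the
    convolution mu o (f x g) o Delta of two such maps is again one.

    Primitive elements.  Let Psi n be the n-th convolution power of the identity.
    Since H is graded and connected, Psi n x is a polynomial in n for each x
    (Psi_poly); write euler k x for its coefficients.  They lie in every subspace
    containing the values Psi n x, so that euler k preserves polars too.  By
    cocommutativity Psi n is a coalgebra endomorphism (cop_Psi), and comparing
    the coefficients of degree one in n gives that euler 1 x is primitive.
    Comparing coefficients in Psi (m + n) = Psi m * Psi n gives
    (k + 1) euler (k + 1) = euler 1 * euler k (euler_rec), and n = 1 gives
    x = sum_k euler k x.  So H is generated by its primitive elements.

    The isomorphism.  Multiplying out words defines psi from the envelope U to H
    (env_psi).  Conversely the exponential of the map e1 given by euler 1, taken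
    in the full tensor algebra of the primitive elements, sends x to a
    combination of words with independent letters, and its class in U is Phi x;
    psi (Phi x) = sum_k euler k x = x.  If x T y, the letters in the exponential
    of x are independent of y, hence of those in a suitable representative of the
    exponential of y: Phi preserves independence.  For surjectivity of Phi, let w
    be a word of length n.  The coproduct of its product distributes the letters
    in all ways (cop_prodw), so the components of degree greater than n of the
    exponential vanish on it, while the one of degree n is the mean of
    reorderings of w modulo shorter words (theta_prodw), that is w itself because
    letters commute in U up to brackets (wcong_move).  Induction on n shows that
    Phi reaches w.

    So Phi is a linear bijection that respects independence, products and unit in
    both directions, and the coproduct, counit and antipode of H are transported
    to U along it (transport_is_hopf). *)

(** * Linear algebra *)

Section Spans.
Variables (K : fieldType) (V : lmodType K).
Implicit Types S : set V.

Lemma subspace0 S : subspace S -> S 0. Proof. by case. Qed.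

Lemma subspaceD S x y : subspace S -> S x -> S y -> S (x + y).
Proof. by case=> _ sS Sx Sy; rewrite -[x]scale1r; apply: sS. Qed.

Lemma subspaceZ S c x : subspace S -> S x -> S (c *: x).
Proof. by case=> S0 sS Sx; rewrite -[_ *: _]addr0; apply: sS. Qed.

Lemma subspaceB S x y : subspace S -> S x -> S y -> S (x - y).
Proof.
by move=> sS Sx Sy; rewrite -scaleN1r; apply: subspaceD => //; apply: subspaceZ.
Qed.

Lemma subspace_sum S (I : Type) (r : seq I) (P : pred I) (F : I -> V) :
  subspace S -> (forall i, P i -> S (F i)) -> S (\sum_(i <- r | P i) F i).
Proof.
by move=> sS SF; elim/big_rec: _ => [|i x Pi Sx]; [case: sS | apply: subspaceD; auto].
Qed.

Lemma subspace_sum_seq S (I : eqType) (r : seq I) (F : I -> V) :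
  subspace S -> (forall i, i \in r -> S (F i)) -> S (\sum_(i <- r) F i).
Proof.
by move=> sS SF; rewrite big_seq; apply: subspace_sum.
Qed.

Lemma span_incl S x : S x -> span S x.
Proof.
by move=> Sx; rewrite -[x]addr0 -[x]scale1r; apply: spanD => //; apply: span0.
Qed.

Lemma span_min S S' : subspace S' -> S `<=` S' -> span S `<=` S'.
Proof.
by move=> sS' SS' x; elim=> [|c y z /SS' Sy _ Sz]; [case: sS' | apply: sS'.2].
Qed.

Lemma span_mono S S' : S `<=` S' -> span S `<=` span S'.
Proof.
move=> SS'; apply: span_min => [|x /SS']; [exact: span_subspace | exact: span_incl].
Qed.

Lemma span_id S x : subspace S -> span S x -> S x.
Proof. by move=> sS; apply: span_min. Qed.

End Spans.

Section LinearMaps.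
Variables (K : fieldType) (V W : lmodType K).

Lemma span_image (f : {linear V -> W}) (S : set V) (S' : set W) x :
  subspace S' -> (forall y, S y -> S' (f y)) -> span S x -> S' (f x).
Proof.
move=> [S'0 sS'] SS'; elim=> [|c y z Sy _ IH]; first by rewrite linear0.
by rewrite linearP; apply: sS' => //; apply: SS'.
Qed.

Lemma eq_linear_span (f g : {linear V -> W}) (S : set V) x :
  (forall y, S y -> f y = g y) -> span S x -> f x = g x.
Proof.
move=> fg; elim=> [|c y z Sy _ IH]; first by rewrite !linear0.
by rewrite !linearP IH fg.
Qed.

Lemma vquot_lift (S : set V) (f : {linear V -> W}) :
  (forall x, S x -> f x = 0) ->
  exists g : {linear vquot S -> W}, forall x, g (vproj S x) = f x.
Proof.
move=> f0.
have f00 x : span S x -> f x = 0.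
  move=> Sx; have -> : 0 = (\0 : {linear V -> W}) x by [].
  by apply: eq_linear_span Sx => y /f0.
pose g (x : vquot S) := f (repr x).
have gE x : g (vproj S x) = f x.
  apply/eqP; rewrite -subr_eq0 -linearB /=; apply/eqP/f00/vprojP.
  by rewrite vproj_repr.
have gL : linear g.
  move=> c x y; rewrite -[x]vproj_repr -[y]vproj_repr.
  by rewrite -[c *: _ + _](linearP (vproj S)) !gE linearP.
pose mg := GRing.isLinear.Build K (vquot S) W *:%R g gL.
pose gp : {linear vquot S -> W} := HB.pack g mg.
by exists gp.
Qed.

Lemma vquot_ind (S : set V) (P : vquot S -> Prop) :
  (forall x, P (vproj S x)) -> forall x, P x.
Proof. by move=> Px x; rewrite -[x]vproj_repr; apply: Px. Qed.

Lemma vproj_eq0 (S : set V) x : vproj S x = 0 <-> span S x.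
Proof.
have := vprojP S x 0; rewrite subr0 => <-.
by rewrite -[vproj_fun S 0]/(vproj S 0) linear0.
Qed.

Lemma vproj_eq (S : set V) x y : vproj S x = vproj S y <-> span S (x - y).
Proof. exact: vprojP. Qed.

End LinearMaps.

Section FreeModule.
Variables (K : fieldType) (X : choiceType).

Lemma malgUZ c x : << c *g x >> = c *: << x >> :> {malg K[X]}.
Proof. by apply/malgP => y; rewrite mcoeffZ !mcoeffU mulr_natr. Qed.

Lemma malg_span (A : {malg K[X]}) (S : set {malg K[X]}) :
  subspace S -> (forall x, x \in msupp A -> S << x >>) -> S A.
Proof.
move=> sS SA; rewrite [A]monalgE; apply: subspace_sum_seq => // x xA.
by rewrite malgUZ; apply: subspaceZ; auto.
Qed.

Lemma msupp_subspace (P : set X) :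
  subspace [set A : {malg K[X]} | forall x, x \in msupp A -> P x].
Proof.
split=> [x|c A B PA PB x]; first by rewrite msupp0 inE.
move/(fsubsetP (msuppD_le _ _)); rewrite in_fsetU => /orP[|]; last exact: PB.
by move/(fsubsetP (msuppZ_le _ _)); apply: PA.
Qed.

Lemma eq_linear_malg (W : lmodType K) (f g : {linear {malg K[X]} -> W}) A :
  (forall x, x \in msupp A -> f << x >> = g << x >>) -> f A = g A.
Proof.
move=> fg; apply: (malg_span (S := [set A | f A = g A])) => //.
by split=> [|c B C /= fB fC] /=; rewrite ?linear0 // !linearP fB fC.
Qed.

Lemma lext_comp (W W' : lmodType K) (f : {linear W -> W'}) (b : X -> W) A :
  f (lext b A) = lext (f \o b) A.
Proof.
apply: (eq_linear_malg (f := f \o lext b) (g := lext (f \o b))) => x _ /=.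
by rewrite !lextU.
Qed.

Lemma eq_lext (W : lmodType K) (b c : X -> W) (A : {malg K[X]}) :
  (forall x, x \in msupp A -> b x = c x) -> lext b A = lext c A.
Proof. move=> bc; apply: (eq_linear_malg (f := lext b) (g := lext c)) => x xA.
by rewrite /= !lextU bc. Qed.

(** The combination is recorded in a free module, where hypotheses on formal
    relations between the generators can be applied to it. *)
Lemma span_lext (W : lmodType K) (P : set X) (b : X -> W) y :
  span [set b x | x in P] y ->
  exists A : {malg K[X]}, (forall x, x \in msupp A -> P x) /\ lext b A = y.
Proof.
elim=> [|c _ z [x Px <-] _ [A [PA <-]]].
  by exists 0; split=> [x|]; rewrite ?linear0 // msupp0 inE.
exists (c *: << x >> + A); split; last by rewrite lext_linear lextU.
apply: (msupp_subspace P).2 => // x' /(fsubsetP msuppU_le).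
by rewrite in_fset1 => /eqP ->.
Qed.

End FreeModule.

Section LinearExtension.
Variables (K : fieldType) (I : choiceType) (B C : lmodType K).
Variables (P : set I) (b : I -> B) (c : I -> C).
Hypothesis bc : forall A : {malg K[I]}, (forall i, i \in msupp A -> P i) ->
  lext b A = 0 -> lext c A = 0.

Let G0 : set (B * C)%type := [set (b i, c i) | i in P].
(** S is meant as a set of extra pairs: S and the given pairs together span the
    graph of a partial map. *)
Let functional (S : set (B * C)%type) : Prop :=
  forall y, span (S `|` G0) (0, y) -> y = 0.

Lemma functional_G0 y : span G0 (0, y) -> y = 0.
Proof.
move/span_lext => [A [PA bcA]].
have [bA cA] : lext b A = 0 /\ lext c A = y.
  have := congr1 fst bcA; have := congr1 snd bcA => /= <- <-.
  split; first exact: esym (lext_comp fst (fun i => (b i, c i)) A).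
  exact: esym (lext_comp snd (fun i => (b i, c i)) A).
by rewrite -cA; apply: bc.
Qed.

(** By Zorn's lemma there is a maximal graph of a partial linear map that contains
    the given pairs; if x were outside its domain, the pair (x, 0) could be added. *)
Lemma linear_extension :
  exists f : {linear B -> C}, forall i, P i -> f (b i) = c i.
Proof.
have [F Ffun Ftot|S [Sfun Smax]] := @Zorn_bigcup _ functional.
  have chain z : span ((\bigcup_(X in F) X) `|` G0) z ->
      span G0 z \/ exists2 X, F X & span (X `|` G0) z.
    elim=> [|k u v Gu _ IH]; first by left; exact: span0.
    case: Gu => [[X FX Xu]|Gu].
      right; case: IH => [Gv|[Y FY Yv]].
        exists X => //; apply: (spanD k); first by left.
        by apply: span_mono Gv; exact: subsetUr.
      have [XY|YX] := Ftot X Y FX FY.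
        by exists Y => //; apply: (spanD k) => //; left; apply: XY.
      exists X => //; apply: (spanD k); first by left.
      by apply: span_mono Yv; exact: setSU.
    case: IH => [Gv|[Y FY Yv]]; first by left; apply: spanD.
    by right; exists Y => //; apply: spanD => //; right.
  move=> y /chain[/functional_G0 //|[X FX]]; exact: Ffun.
have sG := span_subspace (S `|` G0).
have Gtot x : exists y, span (S `|` G0) (x, y).
  apply: contrapT => nx; apply: (Smax (S `|` [set (x, 0)])).
    split=> [|sub]; first exact: subsetUl.
    by apply: nx; exists 0; apply: span_incl; left; apply: sub; right.
  move=> y Gy.
  have [k [u [Gu [eu1 eu2]]]] : exists k u, span (S `|` G0) u /\
      (0 = k *: x + u.1 /\ y = u.2).
    have : forall z, span ((S `|` [set (x, 0)]) `|` G0) z -> exists k u,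
        span (S `|` G0) u /\ (z.1 = k *: x + u.1 /\ z.2 = u.2).
      move=> z; elim=> [|k u v Hu _ [l [w [Gw [e1 e2]]]]].
        by exists 0, 0; split; [exact: span0 | rewrite scale0r addr0].
      have [Gu|->] : span (S `|` G0) u \/ u = (x, 0).
        by case: Hu => [[Su|->]|Gu]; [left|right|left]; rewrite //;
           apply: span_incl; [left|right].
        exists l, (k *: u + w); split; first exact: sG.2.
        by rewrite /= e1 e2 addrCA.
      exists (k + l), w; split=> //=.
      by rewrite e1 e2 scaler0 add0r scalerDl addrA.
    by move/(_ _ Gy).
  have [k0|k0] := eqVneq k 0.
    by apply: Sfun; rewrite {1}eu1 eu2 k0 scale0r add0r -surjective_pairing.
  case: nx; exists (- k^-1 *: u.2).
  suff -> : (x, - k^-1 *: u.2) = - k^-1 *: u by exact: subspaceZ.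
  rewrite [u in RHS]surjective_pairing; congr pair => /=.
  have -> : u.1 = - (k *: x) by apply/eqP; rewrite -addr_eq0 addrC -eu1.
  by rewrite scalerN scaleNr opprK scalerA mulVf // scale1r.
have [f fG] := choice Gtot.
have fE x y : span (S `|` G0) (x, y) -> y = f x.
  move=> Gxy; apply/eqP; rewrite -subr_eq0; apply/eqP/Sfun.
  have -> : (0, y - f x) = (x, y) - (x, f x) by rewrite -[RHS]/(_, _) subrr.
  exact: subspaceB.
have fL : linear f.
  by move=> k x y; apply/esym/fE; exact: sG.2 k (x, f x) (y, f y) (fG x) (fG y).
pose mf := GRing.isLinear.Build K B C *:%R f fL.
exists (HB.pack f mf : {linear B -> C}) => i Pi /=.
by apply/esym/fE/span_incl; right; exists i.
Qed.

End LinearExtension.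

(** * Tensor products from their universal property *)

Section TensorTheory.
Variables (K : fieldType) (U V : lmodType K).

Lemma tens_bilinear : bilinear_map (@tens K U V).
Proof. by split=> [v|u] c a b; rewrite ?tensDl ?tensDr ?tensZl ?tensZr. Qed.

Lemma tclass_lext (X : {malg K[(U * V)%type]}) :
  tclass X = lext (fun p => tens p.1 p.2) X.
Proof.
apply: (eq_linear_malg (f := tclass) (g := lext (fun p => tens p.1 p.2))).
by move=> [u v] _ /=; rewrite lextU.
Qed.

Lemma tensor_class (t : tensor U V) : exists X, tclass X = t.
Proof. by exists (repr t); exact: vproj_repr. Qed.

Lemma tensor_span (t : tensor U V) : span [set t | exists u v, t = tens u v] t.
Proof.
have [X <-] := tensor_class t; rewrite tclass_lext.
apply: subspace_sum_seq => [|[u v] _]; first exact: span_subspace.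
by apply: subspaceZ; [exact: span_subspace | apply: span_incl; exists u, v].
Qed.

Lemma eq_tensor (W : lmodType K) (f g : {linear tensor U V -> W}) :
  (forall u v, f (tens u v) = g (tens u v)) -> forall t, f t = g t.
Proof.
move=> fg t; apply: (eq_linear_span (f := f) (g := g)) (tensor_span t).
by move=> _ [u [v ->]].
Qed.

Variables (W : lmodType K) (f : U -> V -> W).
Hypothesis fb : bilinear_map f.

Lemma tlift_tens u v : tlift f (tens u v) = f u v.
Proof. by rewrite /tens tliftE // lextU. Qed.

Lemma tlift_linear : linear (tlift f).
Proof.
move=> c t t'; have [X <-] := tensor_class t; have [Y <-] := tensor_class t'.
by rewrite -linearP !tliftE // lext_linear.
Qed.

Definition tlift_map : {linear tensor U V -> W} :=
  HB.pack (tlift f) (GRing.isLinear.Build K _ _ *:%R (tlift f) tlift_linear).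

End TensorTheory.

(** All that is used of the tensor product is its universal property.  The
    coalgebra identities below live in threefold and fourfold tensor products,
    and are proved for any construction with this property. *)
Record tensor_theory (K : fieldType) := TensorTheory {
  tprod : lmodType K -> lmodType K -> lmodType K;
  tpure : forall U V : lmodType K, U -> V -> tprod U V;
  tpure_bilinear : forall U V, bilinear_map (@tpure U V);
  tfactor : forall (U V W : lmodType K) (f : U -> V -> W),
    bilinear_map f -> {linear tprod U V -> W};
  tfactor_pure : forall (U V W : lmodType K) (f : U -> V -> W) fb u v,
    @tfactor U V W f fb (tpure u v) = f u v;
  eq_tprod : forall (U V W : lmodType K) (f g : {linear tprod U V -> W}),
    (forall u v, f (tpure u v) = g (tpure u v)) -> forall t, f t = g t }.

Definition tensor_product (K : fieldType) : tensor_theory K :=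
  @TensorTheory K (fun U V => tensor U V : lmodType K) (@tens K)
    (@tens_bilinear K) (@tlift_map K) (@tlift_tens K) (@eq_tensor K).

Section TensorMaps.
Variables (K : fieldType) (X : tensor_theory K).
Local Notation "U ** V" := (tprod X U V) (at level 40, left associativity).
Local Notation "u <*> v" := (tpure X u v) (at level 40, left associativity).

Section Pure.
Variables U V : lmodType K.

Definition tpurel (v : V) (u : U) : U ** V := u <*> v.
HB.instance Definition _ v := GRing.isLinear.Build K U (U ** V) *:%R (tpurel v)
  ((tpure_bilinear X U V).1 v).

Definition tpurer (u : U) (v : V) : U ** V := u <*> v.
HB.instance Definition _ u := GRing.isLinear.Build K V (U ** V) *:%R (tpurer u)
  ((tpure_bilinear X U V).2 u).

Lemma tpureZl c (u : U) (v : V) : (c *: u) <*> v = c *: (u <*> v).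
Proof. exact: (linearZ_LR (tpurel v)). Qed.

Lemma tpureZr c (u : U) (v : V) : u <*> (c *: v) = c *: (u <*> v).
Proof. exact: (linearZ_LR (tpurer u)). Qed.

Lemma tprod_ind (P : set (U ** V)) :
  subspace P -> (forall u v, P (u <*> v)) -> forall t, P t.
Proof.
move=> sP Puv t; have /vproj_eq0 : vproj P t = 0.
  apply: (eq_tprod (f := vproj P) (g := \0)) => u v /=.
  by apply/vproj_eq0/span_incl.
exact: span_id.
Qed.

End Pure.

Lemma bilinear_tpure (U V U' V' : lmodType K)
    (f : {linear U -> U'}) (g : {linear V -> V'}) :
  bilinear_map (fun u v => f u <*> g v).
Proof.
split=> [v|u] c a b.
  exact: (linearP (tpurel (g v) \o f)).
exact: (linearP (tpurer (f u) \o g)).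
Qed.

Definition tmapX (U V U' V' : lmodType K)
    (f : {linear U -> U'}) (g : {linear V -> V'}) : {linear U ** V -> U' ** V'} :=
  tfactor X (bilinear_tpure f g).

Lemma tmapX_pure (U V U' V' : lmodType K)
    (f : {linear U -> U'}) (g : {linear V -> V'}) u v :
  tmapX f g (u <*> v) = f u <*> g v.
Proof. exact: tfactor_pure. Qed.

Lemma tmapX_lext (U V U' V' W : lmodType K) (F : {linear U' ** V' -> W})
    (f : {linear U -> U'}) (g : {linear V -> V'}) (A : {malg K[(U * V)%type]}) :
  F (tmapX f g (lext (fun p => p.1 <*> p.2) A)) =
  lext (fun p => F (f p.1 <*> g p.2)) A.
Proof.
rewrite -[LHS]/((F \o tmapX f g) _) lext_comp; apply: eq_lext => p _ /=.
by rewrite tmapX_pure.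
Qed.

Lemma tmapX_comp (U V U' V' U'' V'' : lmodType K)
    (f : {linear U -> U'}) (g : {linear V -> V'})
    (f' : {linear U' -> U''}) (g' : {linear V' -> V''}) t :
  tmapX f' g' (tmapX f g t) = tmapX (f' \o f) (g' \o g) t.
Proof.
apply: (eq_tprod (f := tmapX f' g' \o tmapX f g)) => u v /=.
by rewrite !tmapX_pure.
Qed.

Lemma eq_tmapX (U V U' V' : lmodType K)
    (f f' : {linear U -> U'}) (g g' : {linear V -> V'}) :
  f =1 f' -> g =1 g' -> tmapX f g =1 tmapX f' g'.
Proof. by move=> ff gg; apply: eq_tprod => u v; rewrite !tmapX_pure ff gg. Qed.

Lemma tmapX_id (U V : lmodType K) (t : U ** V) : tmapX idfun idfun t = t.
Proof. by apply: (eq_tprod (g := idfun)) => u v; rewrite tmapX_pure. Qed.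

Lemma lext_tpure (I J : choiceType) (U V W : lmodType K)
    (F : {linear U ** V -> W}) (b : I -> U) (c : J -> V) A B :
  F (lext b A <*> lext c B) = lext (fun p => lext (fun q => F (b p <*> c q)) B) A.
Proof.
rewrite -[LHS]/((F \o tpurel (lext c B)) _) lext_comp; apply: eq_lext => p _ /=.
by rewrite -[LHS]/((F \o tpurer (b p)) _) lext_comp.
Qed.

Lemma bilinear_swap (U V : lmodType K) : bilinear_map (fun (u : U) (v : V) => v <*> u).
Proof. by split=> [v|u]; [case: (tpure_bilinear X V U) | case: (tpure_bilinear X V U)]. Qed.

Definition tswapX (U V : lmodType K) : {linear U ** V -> V ** U} :=
  tfactor X (@bilinear_swap U V).

Lemma tswapX_pure (U V : lmodType K) (u : U) (v : V) : tswapX U V (u <*> v) = v <*> u.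
Proof. exact: tfactor_pure. Qed.

Lemma eq_tprod3 (A B C W : lmodType K) (f g : {linear A ** B ** C -> W}) :
  (forall a b c, f (a <*> b <*> c) = g (a <*> b <*> c)) -> forall t, f t = g t.
Proof.
move=> fg; apply: eq_tprod => s c.
by apply: (eq_tprod (f := f \o tpurel c) (g := g \o tpurel c)) => a b; exact: fg.
Qed.

Lemma eq_tprod4 (A B C D W : lmodType K) (f g : {linear A ** B ** (C ** D) -> W}) :
  (forall a b c d, f (a <*> b <*> (c <*> d)) = g (a <*> b <*> (c <*> d))) ->
  forall t, f t = g t.
Proof.
move=> fg; apply: eq_tprod3 => a b s.
apply: (eq_tprod (f := f \o tpurer (a <*> b)) (g := g \o tpurer (a <*> b))) => c d.
exact: fg.
Qed.

Section Assoc.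
Variables A B C : lmodType K.

Lemma bilinear_assoc1 (c : C) : bilinear_map (fun (a : A) (b : B) => a <*> (b <*> c)).
Proof. exact: (bilinear_tpure idfun (tpurel c)). Qed.

Lemma bilinear_assoc :
  bilinear_map (fun (t : A ** B) (c : C) => tfactor X (bilinear_assoc1 c) t).
Proof.
split=> [c|t k c c']; first exact: linearP.
pose F c := tfactor X (bilinear_assoc1 c).
apply: (tprod_ind (P := [set t | F (k *: c + c') t = k *: F c t + F c' t])).
  split=> [|l x y /= ex ey] /=; first by rewrite !linear0 addr0.
  by rewrite !linearP ex ey !scalerDr !scalerA [l * k]mulrC addrACA.
move=> a b /=; rewrite /F !tfactor_pure.
exact: (linearP (tpurer a \o tpurer b)).
Qed.

Definition tassocX : {linear A ** B ** C -> A ** (B ** C)} :=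
  tfactor X bilinear_assoc.

Lemma tassocX_pure a b c : tassocX (a <*> b <*> c) = a <*> (b <*> c).
Proof. by rewrite /tassocX !tfactor_pure. Qed.

End Assoc.

Section AssocInverse.
Variables A B C : lmodType K.

Definition tassocVX : {linear A ** (B ** C) -> A ** B ** C} :=
  tswapX C (A ** B) \o tmapX idfun (tswapX B A) \o tassocX C B A
    \o tswapX A (C ** B) \o tmapX idfun (tswapX B C).

Lemma tassocVX_pure a b c : tassocVX (a <*> (b <*> c)) = a <*> b <*> c.
Proof. by rewrite /= !(tmapX_pure, tswapX_pure, tassocX_pure). Qed.

Lemma tassocXK : cancel (tassocX A B C) tassocVX.
Proof.
apply: (eq_tprod3 (f := tassocVX \o tassocX A B C) (g := idfun)) => a b c.
by rewrite -[LHS]/(tassocVX (tassocX A B C _)) tassocX_pure tassocVX_pure.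
Qed.

End AssocInverse.

(** The exchange of the two middle factors of a fourfold tensor product, written
    with the associativity isomorphisms so that its linearity comes for free. *)
Definition midswap (A B C D : lmodType K) :
    {linear A ** B ** (C ** D) -> A ** C ** (B ** D)} :=
  tassocVX A C (B ** D)
    \o tmapX idfun (tassocX C B D \o tmapX (tswapX B C) idfun \o tassocVX B C D)
    \o tassocX A B (C ** D).

Lemma midswap_pure (A B C D : lmodType K) (a : A) (b : B) (c : C) (d : D) :
  midswap A B C D (a <*> b <*> (c <*> d)) = a <*> c <*> (b <*> d).
Proof.
rewrite -[LHS]/(tassocVX A C (B ** D) (tmapX _ _ (tassocX A B (C ** D) _))).
rewrite tassocX_pure tmapX_pure -[X in _ <*> X]/(tassocX C B D
  (tmapX _ _ (tassocVX B C D _))).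
by rewrite tassocVX_pure tmapX_pure tswapX_pure tassocX_pure tassocVX_pure.
Qed.

End TensorMaps.

Arguments tpure {K} _ {U V}.
Arguments tassocX {K} X A B C.
Arguments tswapX {K} X U V.
Arguments midswap {K} X A B C D.

(** * Polynomial functions on the natural numbers *)

Section PolynomialFunctions.
Variable K : fieldType.
Hypothesis natK : forall n, n.+1%:R != 0 :> K.

Lemma natr_injective : injective (fun n => n%:R : K).
Proof.
have H m n : (m <= n)%N -> m%:R = n%:R :> K -> m = n.
  move=> mn /eqP; rewrite -(subnK mn) eq_sym -subr_eq0 natrD addrK.
  by case: (n - m)%N => [|d]; rewrite ?add0n // (negPf (natK d)).
by move=> m n mn; case: (leqP m n) => [/H|/ltnW/H] -> //.
Qed.

Section OneSpace.
Variable W : lmodType K.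
Implicit Types (v w a b : nat -> W) (S : set W).

(** Polynomial functions with values in a vector space, which are not elements of
    any polynomial ring; their coefficients are given as an infinite sequence so
    that the degree can be changed freely. *)
Definition poly_fun v a : Prop := exists N, (forall k, (N <= k)%N -> a k = 0) /\
  forall n, v n = \sum_(k < N) n%:R ^+ k *: a k.

Lemma poly_fun_widen a N M n : (forall k, (N <= k)%N -> a k = 0) -> (N <= M)%N ->
  \sum_(k < N) (n%:R : K) ^+ k *: a k = \sum_(k < M) n%:R ^+ k *: a k.
Proof.
move=> a0 NM; rewrite (big_ord_widen M (fun k => n%:R ^+ k *: a k)) // big_mkcond.
apply: eq_bigr => k _; case: ifP => // /negbT; rewrite -leqNgt => /a0 ->.
by rewrite scaler0.
Qed.

Lemma eq_poly_fun v w a b : v =1 w -> a =1 b -> poly_fun v a -> poly_fun w b.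
Proof.
move=> vw ab [N [a0 va]]; exists N; split=> [k /a0|n]; first by rewrite ab.
by rewrite -vw va; apply: eq_bigr => k _; rewrite ab.
Qed.

Lemma poly_fun_comb c v w a b : poly_fun v a -> poly_fun w b ->
  poly_fun (fun n => c *: v n + w n) (fun k => c *: a k + b k).
Proof.
move=> [N [a0 va]] [M [b0 wb]]; exists (maxn N M); split=> [k|n].
  by rewrite geq_max => /andP[/a0 -> /b0 ->]; rewrite scaler0 addr0.
rewrite va wb (poly_fun_widen _ a0 (leq_maxl N M)).
rewrite (poly_fun_widen _ b0 (leq_maxr N M)) scaler_sumr -big_split.
by apply: eq_bigr => k _ /=; rewrite scalerDr !scalerA mulrC.
Qed.

Lemma poly_fun0 : poly_fun (fun=> 0) (fun=> 0).
Proof. by exists 0%N; split=> // n; rewrite big_ord0. Qed.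

Lemma poly_fun_cst x : poly_fun (fun=> x) (fun k => if k == 0%N then x else 0).
Proof.
exists 1%N; split=> [[|k]|n] //.
by rewrite big_ord1 expr0 scale1r.
Qed.

Lemma poly_fun_sum (I : Type) (r : seq I) (v a : I -> nat -> W) :
  (forall i, poly_fun (v i) (a i)) ->
  poly_fun (fun n => \sum_(i <- r) v i n) (fun k => \sum_(i <- r) a i k).
Proof.
move=> va; elim: r => [|i r IH].
  by apply: eq_poly_fun poly_fun0 => n; rewrite big_nil.
by apply: eq_poly_fun (poly_fun_comb 1 (va i) IH) => n; rewrite big_cons scale1r.
Qed.

Lemma poly_fun_horner (p : {poly K}) x :
  poly_fun (fun n => p.[n%:R] *: x) (fun k => p`_k *: x).
Proof.
exists (size p); split=> [k kp|n]; first by rewrite nth_default ?scale0r.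
rewrite horner_coef scaler_suml; apply: eq_bigr => k _.
by rewrite scalerA mulrC.
Qed.

Lemma poly_fun_at0 v a : poly_fun v a -> v 0%N = a 0%N.
Proof.
move=> [N [a0 va]]; rewrite va (poly_fun_widen _ a0 (leqnSn N)) big_ord_recl /=.
by rewrite expr0 scale1r big1 ?addr0 // => k _; rewrite expr0n scale0r.
Qed.

Lemma poly_fun_uniq0 v a : poly_fun v a -> (forall n, v n = 0) -> forall k, a k = 0.
Proof.
move=> [N [a0 va]] v0 k; apply: contrapT => ak.
(* A linear form separating a k from 0 reduces to the uniqueness of the
   coefficients of a polynomial over an infinite field. *)
have [f fa] : exists f : {linear W -> K^o}, f (a k) = 1.
  have [|f fE] := @linear_extension K unit W K^o setT (fun=> a k) (fun=> 1).
    move=> A _; rewrite -[lext _ A]/(\sum_(p <- msupp A) A@_p *: a k).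
    rewrite -scaler_suml => /eqP; rewrite scaler_eq0 => /orP[/eqP|/eqP //].
    by move=> A0; rewrite /lext -scaler_suml A0 scale0r.
  by exists f; apply: (fE tt).
pose p := \poly_(j < N) (f (a j) : K).
have p0 : p = 0.
  apply: (@roots_geq_poly_eq0 K p [seq i%:R | i <- iota 0 N]).
  - apply/allP => _ /mapP [n _ ->]; apply/eqP; rewrite horner_poly.
    have := congr1 f (va n); rewrite v0 linear0 linear_sum => e.
    rewrite [RHS]e; apply: eq_bigr => j _.
    by rewrite linearZ mulrC.
  - by rewrite map_inj_uniq ?iota_uniq //; exact: natr_injective.
  by rewrite size_map size_iota size_poly.
have kN : (k < N)%N by rewrite ltnNge; apply/negP => /a0.
have : p`_k = 0 by rewrite p0 coef0.
by rewrite coef_poly kN fa => /eqP; rewrite oner_eq0.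
Qed.

Lemma poly_fun_uniq v a b : poly_fun v a -> poly_fun v b -> a =1 b.
Proof.
move=> va vb k; apply/eqP; rewrite eq_sym -subr_eq0 addrC -scaleN1r; apply/eqP.
apply: (poly_fun_uniq0 (poly_fun_comb (-1) va vb)) => n.
by rewrite scaleN1r addNr.
Qed.

End OneSpace.

Lemma poly_fun_linear (W W' : lmodType K) (f : {linear W -> W'}) v a :
  poly_fun v a -> poly_fun (f \o v) (f \o a).
Proof.
move=> [N [a0 va]]; exists N; split=> [k /a0 /= ->|n /=]; first exact: linear0.
by rewrite va linear_sum; apply: eq_bigr => k _; rewrite linearZ.
Qed.

(** The coefficients are linear combinations of the values: passing to the
    quotient by S turns this into the uniqueness of coefficients. *)
Lemma poly_fun_subspace (W : lmodType K) (S : set W) v a : subspace S ->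
  poly_fun v a -> (forall n, S (v n)) -> forall k, S (a k).
Proof.
move=> sS va vS k; apply: (span_id sS); apply/vproj_eq0.
apply: (poly_fun_uniq0 (poly_fun_linear (vproj S) va)) => n /=.
exact/vproj_eq0/span_incl.
Qed.

(** The coefficient of degree one of a product is singled out because it is the
    one that expresses primitivity. *)
Lemma poly_fun_bilinear (U V W : lmodType K) (B : U -> V -> W) u v a b :
  bilinear_map B -> poly_fun u a -> poly_fun v b ->
  exists2 c, poly_fun (fun n => B (u n) (v n)) c &
    c 1%N = B (a 1%N) (b 0%N) + B (a 0%N) (b 1%N).
Proof.
move=> [Bl Br] [N [a0 ua]] [M [b0 vb]].
pose mBl v : {linear U -> W} :=
  HB.pack (B^~ v) (GRing.isLinear.Build K U W *:%R (B^~ v) (Bl v)).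
pose mBr u : {linear V -> W} :=
  HB.pack (B u) (GRing.isLinear.Build K V W *:%R (B u) (Br u)).
have Bsuml y k (F : 'I_k -> U) : B (\sum_i F i) y = \sum_i B (F i) y.
  exact: (linear_sum (mBl y)).
have Bsumr x k (F : 'I_k -> V) : B x (\sum_i F i) = \sum_i B x (F i).
  exact: (linear_sum (mBr x)).
have BZl c x y : B (c *: x) y = c *: B x y by exact: (linearZ_LR (mBl y)).
have BZr c x y : B x (c *: y) = c *: B x y by exact: (linearZ_LR (mBr x)).
have Bn n : B (u n) (v n) = \sum_(i < N.+2) \sum_(j < M.+2)
    ('X^(i + j)).[n%:R] *: B (a i) (b j).
  rewrite ua vb (poly_fun_widen _ a0 (leqW (leqnSn N))).
  rewrite (poly_fun_widen _ b0 (leqW (leqnSn M))).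
  rewrite Bsuml; apply: eq_bigr => i _; rewrite Bsumr; apply: eq_bigr => j _.
  by rewrite BZr BZl scalerA hornerXn exprD mulrC.
exists (fun k => \sum_(i < N.+2) \sum_(j < M.+2) 'X^(i + j)`_k *: B (a i) (b j)).
  apply: eq_poly_fun (fun n => esym (Bn n)) (fun k => erefl _) _.
  apply: poly_fun_sum => i; apply: poly_fun_sum => j; exact: poly_fun_horner.
have X1 n : 'X^n`_1 = (n == 1%N)%:R :> K by rewrite coefXn eq_sym.
rewrite !big_ord_recl /= !X1 /= !scale0r !scale1r !add0r addrC.
rewrite !big1 ?addr0 // => i _; rewrite ?big_ord_recl ?big1 /= ?X1 /= ?scale0r ?addr0 // => j _.
all: by rewrite X1 /= scale0r.
Qed.

(** Taylor's formula to first order: the coefficient of m in v (m + n) is the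
    derivative of v at n. *)
Lemma poly_fun_shift (W : lmodType K) (v a : nat -> W) : poly_fun v a ->
  exists b : nat -> nat -> W, (forall n, poly_fun (fun m => v (m + n)%N) (b n)) /\
    poly_fun (fun n => b n 1%N) (fun k => k.+1%:R *: a k.+1).
Proof.
move=> [N [a0 va]].
exists (fun n j => \sum_(k < N) (n%:R ^+ (k - j) *+ 'C(k, j)) *: a k).
split=> [n|].
  pose p k : {poly K} := \poly_(j < k.+1) (n%:R ^+ (k - j) *+ 'C(k, j)).
  apply: (@eq_poly_fun _ (fun m => \sum_(k < N) (p k).[m%:R] *: a k) _
    (fun j => \sum_(k < N) (p k)`_j *: a k)).
  - move=> m; rewrite va; apply: eq_bigr => k _; congr (_ *: _).
    rewrite horner_poly addnC natrD exprDn; apply: eq_bigr => j _.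
    by rewrite mulrnAl.
  - move=> j; apply: eq_bigr => k _; rewrite coef_poly ltnS.
    by case: leqP => // kj; rewrite bin_small.
  by apply: poly_fun_sum => k; exact: poly_fun_horner.
apply: (@eq_poly_fun _ (fun n => \sum_(k < N) (('X^(k.-1) *+ k).[n%:R] *: a k)) _
  (fun j => \sum_(k < N) ('X^(k.-1) *+ k)`_j *: a k)).
- by move=> n; apply: eq_bigr => k _; rewrite hornerMn hornerXn bin1 subn1.
- move=> j; rewrite -(big_mkord xpredT (fun k => ('X^(k.-1) *+ k)`_j *: a k)).
  have [jN|Nj] := ltnP j.+1 N; last first.
    rewrite a0 // scaler0 big_nat_cond; apply: big1 => k /andP[/andP[_ kN] _].
    rewrite coefMn coefXn; case: k kN => [|k] kN; first by rewrite mulr0n scale0r.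
    by rewrite /= gtn_eqF ?mul0rn ?scale0r // -ltnS (leq_trans kN).
  rewrite (bigD1_seq j.+1) ?iota_uniq ?mem_index_iota //=.
  rewrite big1 ?addr0 => [|[|k] kj]; rewrite coefMn coefXn /=.
  - by rewrite eqxx.
  - by rewrite mulr0n scale0r.
  by rewrite eq_sym -(inj_eq succn_inj) (negPf kj) mul0rn scale0r.
by apply: poly_fun_sum => k; exact: poly_fun_horner.
Qed.

(** The telescoping sum of (i + 1) ^ (k + 1) - i ^ (k + 1) expresses k + 1 times the
    sum of the k-th powers by the sums of lower powers. *)
Lemma faulhaber k : exists p : {poly K},
  forall n, \sum_(i < n) (i%:R : K) ^+ k = p.[n%:R].
Proof.
elim/ltn_ind: k => k IH.
have /choice [p pE] : forall j : 'I_k, exists p : {poly K},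
    forall n, \sum_(i < n) (i%:R : K) ^+ j = p.[n%:R] by move=> j; apply: IH.
exists (k.+1%:R^-1 *: ('X^(k.+1) - \sum_(j < k) p j *+ 'C(k.+1, j))) => n.
rewrite hornerZ hornerD hornerN hornerXn horner_sum.
apply: (canRL (mulKf (natK k))); apply/eqP; rewrite eq_sym subr_eq; apply/eqP.
have -> : n%:R ^+ k.+1 = \sum_(i < n) ((i.+1%:R : K) ^+ k.+1 - i%:R ^+ k.+1).
  rewrite -(big_mkord xpredT (fun i => (i.+1%:R : K) ^+ k.+1 - i%:R ^+ k.+1)).
  by rewrite telescope_sumr // expr0n subr0.
have -> : \sum_(j < k) (p j *+ 'C(k.+1, j)).[n%:R] =
    \sum_(i < n) \sum_(j < k) (i%:R : K) ^+ j *+ 'C(k.+1, j).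
  rewrite exchange_big; apply: eq_bigr => j _.
  by rewrite hornerMn -pE sumrMnl.
rewrite mulr_sumr -big_split; apply: eq_bigr => i _ /=.
rewrite -nat1r exprDn !big_ord_recr /= !expr1n !binn binSn.
rewrite !mul1r mulr1n. rewrite addrK addrC mulr_natl; congr (_ + _).
by apply: eq_bigr => j _; rewrite expr1n mul1r.
Qed.

Lemma poly_fun_antidifference (W : lmodType K) (v a : nat -> W) :
  poly_fun (fun n => v n.+1 - v n) a -> exists b, poly_fun v b.
Proof.
move=> [N [_ va]]; have /choice [p pE] := faulhaber.
pose b k := 1 *: (if k == 0%N then v 0%N else 0) + \sum_(j < N) (p j)`_k *: a j.
exists b; apply: eq_poly_fun (fun k => erefl _)
  (poly_fun_comb 1 (poly_fun_cst (v 0%N)) (poly_fun_sum _ (fun j : 'I_N =>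
    poly_fun_horner (p j) (a j)))) => n.
rewrite scale1r; apply/eqP; rewrite addrC eq_sym -subr_eq; apply/eqP.
rewrite -(telescope_sumr v (leq0n n)) big_mkord.
under eq_bigr => i _ do rewrite va.
rewrite exchange_big; apply: eq_bigr => j _ /=.
by rewrite -pE scaler_suml.
Qed.

End PolynomialFunctions.

(** * Convolution powers of the identity *)

Section Convolution.
Variables (K : fieldType) (X : tensor_theory K) (H : lmodType K) (T : rel H).
Local Notation "U ** V" := (tprod X U V) (at level 40, left associativity).
Local Notation "u <*> v" := (tpure X u v) (at level 40, left associativity).
Local Notation "f <**> g" := (tmapX X f g) (at level 40, left associativity).

(** The tensors of independent pairs that are moreover independent of U.  Varying
    U is how independence of further elements is carried through a coproduct. *)
Definition indep_tensor (U : set H) : set (H ** H) := span [set t |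
  exists a b, [/\ polar T U a, polar T U b, T a b & t = a <*> b]].

(** A cocommutative locality bialgebra whose product is extended to all pairs.
    The counit axioms speak of any linear map with the values required on pure
    tensors, since the universal property determines it by these values. *)
Record locality_bialgebra_model (mu : {linear H ** H -> H}) (e : H)
    (Dl : {linear H -> H ** H}) (eps : {linear H -> K^o}) : Prop := {
  lb_sym : symmetric T;
  lb_polar : forall U, subspace (polar T U);
  lb_top1 : forall a, T e a;
  lb_topM : forall a b c, T a b -> T a c -> T b c -> T (mu (a <*> b)) c;
  lb_mulA : forall a b c, T a b -> T a c -> T b c ->
    mu (mu (a <*> b) <*> c) = mu (a <*> mu (b <*> c));
  lb_mul1x : forall a, mu (e <*> a) = a;
  lb_mulx1 : forall a, mu (a <*> e) = a;
  lb_cop_top : forall U x, polar T U x -> indep_tensor U (Dl x);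
  lb_copA : forall x,
    tassocX X H H H ((Dl <**> idfun) (Dl x)) = (idfun <**> Dl) (Dl x);
  lb_counitl : forall (f : {linear H ** H -> H}),
    (forall a b, f (a <*> b) = (eps a : K) *: b) -> forall x, f (Dl x) = x;
  lb_counitr : forall (f : {linear H ** H -> H}),
    (forall a b, f (a <*> b) = (eps b : K) *: a) -> forall x, f (Dl x) = x;
  lb_copM : forall x y, T x y ->
    Dl (mu (x <*> y)) = (mu <**> mu) (midswap X H H H H (Dl x <*> Dl y));
  lb_cop1 : Dl e = e <*> e;
  lb_eps1 : eps e = 1;
  lb_copC : forall x, tswapX X H H (Dl x) = Dl x }.

Variables (mu : {linear H ** H -> H}) (e : H) (Dl : {linear H -> H ** H}).
Variable eps : {linear H -> K^o}.
Hypothesis hH : locality_bialgebra_model mu e Dl eps.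
Let Tsym := lb_sym hH.

(** Independence of the identity.  It gives stability of all polars, hence of
    indep_tensor, which locality of f alone would not. *)
Definition top_stable (f : H -> H) : Prop := forall x y, T x y -> T (f x) y.

Lemma polar0 x : polar T set0 x. Proof. by []. Qed.

Lemma polar1 x y : polar T [set y] x <-> T x y.
Proof. by split=> [|Txy u ->]; [apply | ]. Qed.

Lemma top_stable_polar f U x : top_stable f -> polar T U x -> polar T U (f x).
Proof. by move=> fT Ux u /Ux /fT. Qed.

Lemma top_stable_top f g x y : top_stable f -> top_stable g -> T x y ->
  T (f x) (g y).
Proof. by move=> fT gT /fT; rewrite Tsym => /gT; rewrite Tsym. Qed.

Lemma indep_tmap (f g : {linear H -> H}) U t : top_stable f -> top_stable g ->
  indep_tensor U t -> indep_tensor U ((f <**> g) t).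
Proof.
move=> fT gT; apply: span_image => [|_ [a [b [Ua Ub Tab ->]]]].
  exact: span_subspace.
apply: span_incl; exists (f a), (g b); split; last exact: tmapX_pure.
- exact: top_stable_polar.
- exact: top_stable_polar.
exact: top_stable_top.
Qed.

Lemma indep_mul U t : indep_tensor U t -> polar T U (mu t).
Proof.
apply: span_image => [|_ [a [b [Ua Ub Tab ->]]] u Uu]; first exact: lb_polar hH U.
by apply: (lb_topM hH) => //; [apply: Ua | apply: Ub].
Qed.

Definition conv (f g : {linear H -> H}) : {linear H -> H} :=
  mu \o (f <**> g) \o Dl.

Lemma top_stable_conv (f g : {linear H -> H}) :
  top_stable f -> top_stable g -> top_stable (conv f g).
Proof.
move=> fT gT x y Txy; apply: (@indep_mul [set y]) => //.
by apply: indep_tmap => //; apply: (lb_cop_top hH); apply/polar1.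
Qed.

(** In a x c with a independent of c, the coproduct of a can be written with pairs
    that are both independent of c. *)
Lemma indep_cop3 x : span [set t | exists a b c,
  [/\ T a b, T a c, T b c & t = a <*> b <*> c]] ((Dl <**> idfun) (Dl x)).
Proof.
apply: span_image (lb_cop_top hH (polar0 x)) => [|_ [a [c [_ _ Tac ->]]]].
  exact: span_subspace.
rewrite tmapX_pure.
have := lb_cop_top hH ((polar1 a c).2 Tac).
apply: (span_image (f := tpurel X c)) => [|_ [a' [b [Ta Tb Tab ->]]]].
  exact: span_subspace.
by apply: span_incl; exists a', b, c; split; rewrite //; apply/polar1.
Qed.

(** By coassociativity both sides are values at the same element, a combination
    of independent triples, and mu is associative on these. *)
Lemma convA (f g h : {linear H -> H}) :
  top_stable f -> top_stable g -> top_stable h ->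
  conv f (conv g h) =1 conv (conv f g) h.
Proof.
move=> fT gT hT x.
pose L : {linear H ** H ** H -> H} := mu \o ((mu \o (f <**> g)) <**> h).
pose R : {linear H ** (H ** H) -> H} := mu \o (f <**> (mu \o (g <**> h))).
have -> : conv f (conv g h) x = R ((idfun <**> Dl) (Dl x)).
  by rewrite /R [RHS]/= tmapX_comp; congr (mu _); apply: eq_tmapX.
have -> : conv (conv f g) h x = L ((Dl <**> idfun) (Dl x)).
  by rewrite /L [RHS]/= tmapX_comp; congr (mu _); apply: eq_tmapX.
rewrite -(lb_copA hH).
apply: (eq_linear_span (f := R \o tassocX X H H H)) (indep_cop3 x).
move=> _ [a [b [c [Tab Tac Tbc ->]]]].
rewrite /R /L [LHS]/= [RHS]/= tassocX_pure !tmapX_pure [in LHS]/= [in RHS]/=.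
by rewrite !tmapX_pure (lb_mulA hH) //; apply: top_stable_top.
Qed.

Definition counit_unit (x : H) : H := (eps x : K) *: e.
Lemma counit_unit_linear : linear counit_unit.
Proof. by move=> c x y; rewrite /counit_unit linearP scalerDl scalerA. Qed.
HB.instance Definition _ :=
  GRing.isLinear.Build K H H *:%R counit_unit counit_unit_linear.

Lemma bilinear_counitl : bilinear_map (fun a b => (eps a : K) *: b : H).
Proof.
split=> [v|u] c a b /=; first by rewrite linearP scalerDl scalerA.
by rewrite scalerDr !scalerA mulrC.
Qed.

Let counitl : {linear H ** H -> H} := tfactor X bilinear_counitl.
Let counitl_cop x : counitl (Dl x) = x.
Proof. by apply: (lb_counitl hH) => a b; exact: tfactor_pure. Qed.

Lemma conv_unitl (f : {linear H -> H}) : conv counit_unit f =1 f.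
Proof.
move=> x; rewrite -[in RHS](counitl_cop x).
apply: (eq_tprod (f := mu \o (counit_unit <**> f)) (g := f \o counitl)) => a b.
rewrite [LHS]/= [RHS]/= tmapX_pure tfactor_pure linearZ_LR /=.
by rewrite tpureZl linearZ_LR /= (lb_mul1x hH).
Qed.

Fixpoint Psi n : {linear H -> H} :=
  if n is n'.+1 then conv idfun (Psi n') else counit_unit.

Lemma top_stable_id : top_stable idfun. Proof. by []. Qed.

Lemma top_scale1 c a : T (c *: e) a.
Proof.
have /polar1 := subspaceZ c (lb_polar hH [set a]) ((polar1 _ _).2 (lb_top1 hH a)).
by [].
Qed.

Lemma top_stable_Psi n : top_stable (Psi n).
Proof.
elim: n => [|n IH]; first by move=> x y _; exact: top_scale1.
exact: (top_stable_conv top_stable_id IH).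
Qed.

Lemma PsiD m n : Psi (m + n) =1 conv (Psi m) (Psi n).
Proof.
elim: m => [|m IH] x; first exact/esym/conv_unitl.
rewrite addSn -[LHS]/(mu ((idfun <**> Psi (m + n)) (Dl x))).
rewrite (eq_tmapX (frefl _) IH).
exact: convA top_stable_id (top_stable_Psi m) (top_stable_Psi n) x.
Qed.

Lemma Psi1 : Psi 1 =1 idfun.
Proof.
move=> x; apply: (lb_counitr hH (f := mu \o (idfun <**> counit_unit))) => a b.
rewrite [LHS]/= tmapX_pure [X in _ <*> X]/= /counit_unit.
by rewrite tpureZr linearZ_LR /= (lb_mulx1 hH).
Qed.

Lemma tassocX_mapr (A B C C' : lmodType K) (g : {linear C -> C'}) t :
  tassocX X A B C' ((idfun <**> g) t) =
  (idfun <**> (idfun <**> g)) (tassocX X A B C t).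
Proof.
apply: (eq_tprod3 (f := tassocX X A B C' \o (idfun <**> g))
  (g := (idfun <**> (idfun <**> g)) \o tassocX X A B C)) => a b c.
by rewrite [LHS]/= [RHS]/= tassocX_pure !tmapX_pure tassocX_pure.
Qed.

Lemma midswap_map (A B C D A' B' C' D' : lmodType K)
    (f : {linear A -> A'}) (g : {linear B -> B'})
    (h : {linear C -> C'}) (k : {linear D -> D'}) t :
  midswap X A' B' C' D' (((f <**> g) <**> (h <**> k)) t) =
  ((f <**> h) <**> (g <**> k)) (midswap X A B C D t).
Proof.
apply: (eq_tprod4 (f := midswap X A' B' C' D' \o ((f <**> g) <**> (h <**> k)))
  (g := ((f <**> h) <**> (g <**> k)) \o midswap X A B C D)) => a b c d.
rewrite -[LHS]/(midswap X A' B' C' D' _) -[RHS]/(tmapX _ _ _ (midswap X A B C D _)).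
by rewrite midswap_pure !tmapX_pure midswap_pure.
Qed.

(** By coassociativity the two middle factors of the fourfold coproduct are the
    two factors of one coproduct, so cocommutativity applies to them. *)
Lemma midswap_cop x :
  midswap X H H H H ((Dl <**> Dl) (Dl x)) = (Dl <**> Dl) (Dl x).
Proof.
pose P : {linear H -> H ** (H ** H)} := (idfun <**> Dl) \o Dl.
have E : tassocX X H H (H ** H) ((Dl <**> Dl) (Dl x)) = (idfun <**> P) (Dl x).
  have -> : (Dl <**> Dl) (Dl x) = (idfun <**> Dl) ((Dl <**> idfun) (Dl x)).
    by rewrite tmapX_comp; apply: eq_tmapX.
  by rewrite tassocX_mapr (lb_copA hH) tmapX_comp; apply: eq_tmapX.
have inj := can_inj (@tassocXK K X H H (H ** H)); apply: inj.
pose s : {linear H ** (H ** H) -> H ** (H ** H)} :=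
  tassocX X H H H \o (tswapX X H H <**> idfun) \o tassocVX X H H H.
have sP y : s (P y) = P y.
  rewrite -[LHS]/(tassocX X H H H ((tswapX X H H <**> idfun)
    (tassocVX X H H H ((idfun <**> Dl) (Dl y))))).
  rewrite -(lb_copA hH) tassocXK tmapX_comp -[RHS](lb_copA hH).
  congr (tassocX X H H H _); apply: eq_tmapX => // z; exact: lb_copC hH z.
rewrite -[midswap _ _ _ _ _ _]/(tassocVX X H H (H ** H) ((idfun <**> s)
  (tassocX X H H (H ** H) ((Dl <**> Dl) (Dl x))))).
have Q : (idfun <**> s) ((idfun <**> P) (Dl x)) = (idfun <**> P) (Dl x).
  by rewrite tmapX_comp; apply: eq_tmapX.
by rewrite E Q -E tassocXK.
Qed.

Lemma cop_mul U t : indep_tensor U t ->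
  Dl (mu t) = (mu <**> mu) (midswap X H H H H ((Dl <**> Dl) t)).
Proof.
apply: (eq_linear_span (f := Dl \o mu)
  (g := (mu <**> mu) \o midswap X H H H H \o (Dl <**> Dl))) => _ [a [b [_ _ Tab ->]]].
rewrite -[RHS]/(tmapX X mu mu (midswap X H H H H (tmapX X Dl Dl (a <*> b)))).
by rewrite tmapX_pure; exact: (lb_copM hH).
Qed.

(** In the coproduct of Psi (n + 1) x, multiplicativity of Dl brings in the fourfold
    coproduct of x with its middle factors exchanged, and midswap_cop removes the
    exchange. *)
Lemma cop_Psi n x : Dl (Psi n x) = (Psi n <**> Psi n) (Dl x).
Proof.
elim: n x => [|n IH] x.
  pose h : {linear H -> H ** H} := tpurel X e \o counit_unit.
  have -> : Dl (Psi 0 x) = h (counitl (Dl x)).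
    by rewrite counitl_cop /= /tpurel /counit_unit linearZ_LR (lb_cop1 hH) tpureZl.
  apply/esym/(eq_tprod (f := counit_unit <**> counit_unit) (g := h \o counitl)).
  move=> a b; rewrite tmapX_pure [RHS]/= tfactor_pure /counit_unit /tpurel.
  by rewrite linearZ_LR !tpureZl tpureZr scalerA.
have D : indep_tensor set0 ((idfun <**> Psi n) (Dl x)).
  apply: indep_tmap (lb_cop_top hH (polar0 x)) => //; exact: top_stable_Psi.
rewrite [Psi n.+1 x]/= (cop_mul D) tmapX_comp.
have E : ((Dl \o idfun) <**> (Dl \o Psi n)) (Dl x) =
    ((idfun <**> idfun) <**> (Psi n <**> Psi n)) ((Dl <**> Dl) (Dl x)).
  rewrite tmapX_comp; apply: eq_tmapX => y /=; first by rewrite tmapX_id.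
  exact: IH.
rewrite E midswap_map midswap_cop tmapX_comp tmapX_comp.
exact: eq_tmapX.
Qed.

End Convolution.

(** * Eulerian projections *)

Section Eulerian.
Variables (K : fieldType) (X : tensor_theory K) (H : lmodType K) (T : rel H).
Local Notation "U ** V" := (tprod X U V) (at level 40, left associativity).
Local Notation "u <*> v" := (tpure X u v) (at level 40, left associativity).
Local Notation "f <**> g" := (tmapX X f g) (at level 40, left associativity).
Variables (mu : {linear H ** H -> H}) (e : H) (Dl : {linear H -> H ** H}).
Variable eps : {linear H -> K^o}.
Hypothesis hH : locality_bialgebra_model T mu e Dl eps.
Hypothesis natK : forall n, n.+1%:R != 0 :> K.
Variable G : nat -> set H.
Hypothesis Gsum : forall x, exists N f,
  (forall n, G n (f n)) /\ x = \sum_(n < N) f n.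
Hypothesis G0 : forall x, G 0%N x -> exists c : K, x = c *: e.
Hypothesis Gcop : forall n x, G n x -> span [set t | exists p q a b,
  [/\ (p + q = n)%N, G p a, G q b & t = a <*> b]] (Dl x).
Local Notation Psi := (Psi mu e Dl eps).
Local Notation conv := (conv mu Dl).
Local Notation cu := (counit_unit e eps).

Lemma counit_unit_e c : cu (c *: e) = c *: e.
Proof. by rewrite linearZ_LR /= /counit_unit (lb_eps1 hH) scale1r. Qed.

(** The difference of Psi (k + 1) and Psi k is the convolution of Id - u eps with
    Psi k.  As H is connected, Id - u eps kills degree 0, so only values of Psi k
    in degrees less than n occur, and they are polynomial by induction. *)
Lemma Psi_poly_homogeneous n x : G n x -> exists a, poly_fun (Psi^~ x) a.
Proof.
elim/ltn_ind: n x => n IH x Gx.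
pose D k t := mu ((idfun <**> Psi k) t) - mu ((cu <**> Psi k) t).
suff [a Da] : exists a, poly_fun (D ^~ (Dl x)) a.
  apply: (@poly_fun_antidifference K natK H _ a).
  apply: eq_poly_fun Da => // k.
  by rewrite -[in RHS](conv_unitl hH (Psi k)).
apply: (span_min (S' := [set t | exists a, poly_fun (D ^~ t) a])) (Gcop Gx).
  split=> [|c t t' [a ta] [b tb]].
    by exists (fun=> 0); apply: eq_poly_fun (poly_fun0 _) => // k;
      rewrite /D !linear0 addr0.
  exists (fun k => c *: a k + b k); apply: eq_poly_fun (poly_fun_comb c ta tb) => //.
  by move=> k; rewrite /D !linearP scalerDr addrACA.
move=> _ [p [q [a [b [pq Ga Gb ->]]]]].
have DE k : D k (a <*> b) = (mu \o tpurer X (a - cu a)) (Psi k b).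
  rewrite /D !tmapX_pure -linearB -(linearB (tpurel X (Psi k b))).
  by [].
case: p pq Ga => [|p] pq Ga.
  have [c ac] := G0 Ga; exists (fun=> 0); apply: eq_poly_fun (poly_fun0 _) => // k.
  by rewrite DE ac counit_unit_e subrr /= /tpurer -[X in X <*> _](scale0r 0)
    tpureZl scale0r linear0.
have [|c bc] := IH q _ b Gb; first by rewrite -pq addSn ltnS leq_addl.
exists (mu \o tpurer X (a - cu a) \o c).
by apply: eq_poly_fun (poly_fun_linear (mu \o tpurer X (a - cu a)) bc) => // k;
  rewrite DE.
Qed.

Lemma Psi_poly x : exists a, poly_fun (Psi^~ x) a.
Proof.
have [N [f [Gf ->]]] := Gsum x.
have /choice [a fa] : forall n : 'I_N, exists a, poly_fun (Psi^~ (f n)) a.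
  by move=> n; apply: Psi_poly_homogeneous (Gf n).
exists (fun k => \sum_(n < N) a n k).
apply: eq_poly_fun (poly_fun_sum _ fa) => // k.
by rewrite linear_sum.
Qed.

(** The Eulerian projections: the coefficients of the convolution powers of the
    identity as polynomial functions of the exponent. *)
Definition euler k x : H := sval (cid (Psi_poly x)) k.

Lemma eulerP x : poly_fun (Psi^~ x) (euler^~ x).
Proof. exact: (svalP (cid (Psi_poly x))). Qed.

Lemma eulerE x a k : poly_fun (Psi^~ x) a -> euler k x = a k.
Proof. by move=> xa; apply: (poly_fun_uniq natK (eulerP x) xa). Qed.

Lemma euler_linear k : linear (euler k).
Proof.
move=> c x y; apply: (eulerE (a := fun k => c *: euler k x + euler k y)).
apply: eq_poly_fun (poly_fun_comb c (eulerP x) (eulerP y)) => // n.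
by rewrite linearP.
Qed.
HB.instance Definition _ k :=
  GRing.isLinear.Build K H H *:%R (euler k) (euler_linear k).

(** The coefficients of a polynomial function lie in each subspace that contains
    its values. *)
Lemma top_stable_euler k : top_stable T (euler k).
Proof.
move=> x y Txy; apply/polar1.
apply: (poly_fun_subspace natK (lb_polar hH [set y]) (eulerP x)) => n.
by apply/polar1; apply: top_stable_Psi hH n _ _ Txy.
Qed.

Lemma euler0 : euler 0 =1 cu.
Proof. by move=> x; rewrite -(poly_fun_at0 (eulerP x)). Qed.

Lemma euler_sum x : exists N, forall M, (N <= M)%N -> x = \sum_(k < M) euler k x.
Proof.
have [N [x0 xE]] := eulerP x; exists N => M NM.
rewrite -{1}[x](Psi1 hH) xE (poly_fun_widen _ x0 NM).
by apply: eq_bigr => k _; rewrite expr1n scale1r.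
Qed.

Lemma tmap_counitr (f : {linear H -> H}) x : (f <**> cu) (Dl x) = f x <*> e.
Proof.
have bl : bilinear_map (fun a b : H => (eps b : K) *: a).
  split=> [v|u] c a b /=; first by rewrite scalerDr !scalerA mulrC.
  by rewrite linearP scalerDl scalerA.
pose g : {linear H ** H -> H} := tfactor X bl.
have gx : g (Dl x) = x by apply: (lb_counitr hH) => a b; exact: tfactor_pure.
rewrite -[in RHS]gx; apply: (eq_tprod (g := tpurel X e \o f \o g)) => a b /=.
by rewrite tmapX_pure tfactor_pure linearZ_LR /= /tpurel /counit_unit tpureZr tpureZl.
Qed.

Lemma tmap_counitl (f : {linear H -> H}) x : (cu <**> f) (Dl x) = e <*> f x.
Proof.
rewrite -(lb_copC hH) -[RHS](tswapX_pure X) -(tmap_counitr f x).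
apply: (eq_tprod (f := (cu <**> f) \o tswapX X H H)
  (g := tswapX X H H \o (f <**> cu))) => a b /=.
by rewrite tswapX_pure !tmapX_pure tswapX_pure.
Qed.

(** In cop_Psi, the coefficient of n on the right is the value of
    euler 1 x euler 0 + euler 0 x euler 1, and euler 0 is u eps. *)
Lemma euler1_primitive x : Dl (euler 1 x) = euler 1 x <*> e + e <*> euler 1 x.
Proof.
have [c cP c1] : exists2 c, poly_fun (fun n => (Psi n <**> Psi n) (Dl x)) c &
    c 1%N = (euler 1 <**> cu) (Dl x) + (cu <**> euler 1) (Dl x).
  apply: (tprod_ind (P := [set t | exists2 c,
    poly_fun (fun n => (Psi n <**> Psi n) t) c &
    c 1%N = (euler 1 <**> cu) t + (cu <**> euler 1) t])) => [|a b].
    split=> [|k t t' [c tc c1] [c' tc' c1']].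
      exists (fun=> 0); last by rewrite !linear0 addr0.
      by apply: eq_poly_fun (poly_fun0 _) => // n; rewrite linear0.
    exists (fun j => k *: c j + c' j).
      by apply: eq_poly_fun (poly_fun_comb k tc tc') => // n; rewrite linearP.
    by rewrite c1 c1' !linearP scalerDr addrACA.
  have [c cP c1] := poly_fun_bilinear (tpure_bilinear X H H) (eulerP a) (eulerP b).
  exists c; last by rewrite c1 !tmapX_pure !euler0.
  by apply: eq_poly_fun cP => // n; rewrite tmapX_pure.
rewrite -tmap_counitr -tmap_counitl -c1.
apply: (poly_fun_uniq natK (poly_fun_linear Dl (eulerP x))).
by apply: eq_poly_fun cP => // n; rewrite /= (cop_Psi hH).
Qed.

(** Comparison of the coefficients in Psi (m + n) = Psi m * Psi n: first of
    degree one in m, then of degree k in n. *)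
Lemma euler_rec k x :
  k.+1%:R *: euler k.+1 x = mu ((euler 1 <**> euler k) (Dl x)).
Proof.
have tmapl (f : {linear H -> H}) t :
    poly_fun (fun m => (Psi m <**> f) t) (fun j => (euler j <**> f) t).
  apply: (tprod_ind (P := [set t | poly_fun (fun m => (Psi m <**> f) t)
    (fun j => (euler j <**> f) t)])) => [|a b].
    split=> [|c u v tu tv].
      by apply: eq_poly_fun (poly_fun0 _) => // n; rewrite linear0.
    by apply: eq_poly_fun (poly_fun_comb c tu tv) => n; rewrite linearP.
  by apply: eq_poly_fun (poly_fun_linear (tpurel X (f b)) (eulerP a)) => n;
    rewrite tmapX_pure.
have tmapr (f : {linear H -> H}) t :
    poly_fun (fun m => (f <**> Psi m) t) (fun j => (f <**> euler j) t).
  apply: (tprod_ind (P := [set t | poly_fun (fun m => (f <**> Psi m) t)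
    (fun j => (f <**> euler j) t)])) => [|a b].
    split=> [|c u v tu tv].
      by apply: eq_poly_fun (poly_fun0 _) => // n; rewrite linear0.
    by apply: eq_poly_fun (poly_fun_comb c tu tv) => n; rewrite linearP.
  by apply: eq_poly_fun (poly_fun_linear (tpurer X (f a)) (eulerP b)) => n;
    rewrite tmapX_pure.
have [b [bP b1]] := poly_fun_shift (eulerP x).
suff b1' : poly_fun (fun n => b n 1%N) (fun k => mu ((euler 1 <**> euler k) (Dl x))).
  exact: (poly_fun_uniq natK b1 b1' k).
apply: eq_poly_fun (poly_fun_linear mu (tmapr (euler 1) (Dl x))) => // n /=.
suff bP' : poly_fun (fun m => Psi (m + n) x) (fun j => mu ((euler j <**> Psi n) (Dl x))).
  exact: (poly_fun_uniq natK bP' (bP n) 1%N).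
apply: eq_poly_fun (poly_fun_linear mu (tmapl (Psi n) (Dl x))) => // m /=.
by rewrite (PsiD hH).
Qed.

Lemma Psi_one n : Psi n e = e.
Proof.
elim: n => [|n IH] /=; first by rewrite /counit_unit (lb_eps1 hH) scale1r.
by rewrite (lb_cop1 hH) tmapX_pure IH (lb_mul1x hH).
Qed.

Lemma euler1_one : euler 1 e = 0.
Proof.
apply: (eulerE (a := fun k => if k == 0%N then e else 0)).
by apply: eq_poly_fun (poly_fun_cst e) => // n; rewrite Psi_one.
Qed.

Lemma counit_primitive p : Dl p = p <*> e + e <*> p -> eps p = 0.
Proof.
have bl := bilinear_counitl eps.
pose g : {linear H ** H -> H} := tfactor X bl.
have gp : g (Dl p) = p by apply: (lb_counitl hH) => a b; exact: tfactor_pure.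
move=> pP; move: gp; rewrite pP linearD !tfactor_pure (lb_eps1 hH) scale1r.
move/(canRL (addrK _)); rewrite subrr => /(congr1 eps).
by rewrite linearZ_LR (lb_eps1 hH) linear0 => h; rewrite -[LHS]mulr1; exact: h.
Qed.

(** On a primitive element p the power Psi n is multiplication by n. *)
Lemma euler1_id p : Dl p = p <*> e + e <*> p -> euler 1 p = p.
Proof.
move=> pP; have Pn n : Psi n p = n%:R *: p.
  elim: n => [|n IH] /=; first by rewrite /counit_unit (counit_primitive pP) !scale0r.
  rewrite pP !linearD !tmapX_pure /= Psi_one IH (lb_mulx1 hH) (lb_mul1x hH).
  by rewrite -nat1r scalerDl scale1r.
rewrite (eulerE (a := fun k => 'X`_k *: p)); first by rewrite coefX scale1r.
by apply: eq_poly_fun (poly_fun_horner 'X p) => // n; rewrite hornerX Pn.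
Qed.

(** The element x is the sum of the euler k x, and by euler_rec these are built
    from values of euler 1 by products of independent elements. *)
Lemma euler1_generates (B : set H) : subspace B -> B e ->
  (forall a b, B a -> B b -> T a b -> B (mu (a <*> b))) ->
  (forall x, B (euler 1 x)) -> forall x, B x.
Proof.
move=> sB Be BM Be1 x; have [N xE] := euler_sum x; rewrite (xE N) // {xE}.
apply: subspace_sum => // k _; elim: (nat_of_ord k) x => {N k} [|k IH] x.
  by rewrite euler0; exact: subspaceZ.
rewrite -[euler k.+1 x]scale1r -(mulVf (natK k)) -scalerA; apply: subspaceZ => //.
rewrite euler_rec.
apply: (span_image (f := mu \o (euler 1 <**> euler k)))
  (lb_cop_top hH (polar0 T x)) => // _ [a [b [_ _ Tab ->]]].
rewrite [X in B X]/= tmapX_pure; apply: BM; [exact: Be1 | exact: IH |].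
exact: (top_stable_top hH (@top_stable_euler 1) (@top_stable_euler k) Tab).
Qed.

End Eulerian.

(** * The tensor algebra and the envelope *)

Lemma induced_mulP (K : fieldType) (V W : lmodType K) (q : V -> W) (T : rel V)
    (m : V -> V -> V) x y : induced_rel q T x y -> exists a b : V,
  [/\ q a = x, q b = y, T a b & induced_mul q T m x y = q (m a b)].
Proof.
move=> /asboolP [a0 [b0 [xa yb ab]]]; rewrite /induced_mul.
case: xgetP => [[a b] _ [/= ax yb' ab']|/(_ (a0, b0))]; first by exists a, b.
by case.
Qed.

Section FullTensorAlgebra.
Variables (K : fieldType) (g : lmodType K).

Definition multilinear (W : lmodType K) (f : seq g -> W) : Prop :=
  (forall s t a b, f (s ++ (a + b) :: t) = f (s ++ a :: t) + f (s ++ b :: t)) /\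
  (forall s t c a, f (s ++ (c *: a) :: t) = c *: f (s ++ a :: t)).

Definition mult_relations : set {malg K[seq g]} :=
  \bigcup_n (@mult_relation K g n).

(** The whole tensor algebra.  The locality tensor algebra embeds in it, and on
    it concatenation is an everywhere defined bilinear product. *)
Definition talg : lmodType K := vquot mult_relations.

Definition tword (s : seq g) : talg := vproj mult_relations << s >>.

Lemma tword_multilinear : multilinear tword.
Proof.
split=> [s t a b|s t c a].
  rewrite /tword -linearD; apply/vproj_eq/span_incl; exists (size s + size t).+1 => //.
  by rewrite opprD addrA; apply: MultD.
rewrite /tword -linearZ_LR; apply/vproj_eq/span_incl; exists (size s + size t).+1 => //.
exact: MultZ.
Qed.

Lemma vproj_words A : vproj mult_relations A = lext tword A.
Proof.
apply: (eq_linear_malg (f := vproj mult_relations) (g := lext tword)) => s _ /=.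
by rewrite lextU.
Qed.

Lemma eq_talg (W : lmodType K) (f h : {linear talg -> W}) :
  (forall s, f (tword s) = h (tword s)) -> forall t, f t = h t.
Proof.
move=> fh; apply: vquot_ind => A.
by apply: (eq_linear_malg (f := f \o vproj _) (g := h \o vproj _)) => s _; exact: fh.
Qed.

Lemma talg_lift (W : lmodType K) (f : seq g -> W) : multilinear f ->
  exists F : {linear talg -> W}, forall s, F (tword s) = f s.
Proof.
move=> [fD fZ]; have [|F FE] := @vquot_lift K _ _ mult_relations (lext f).
  move=> _ [n _ [s t a b _|s t c a _]]; rewrite !linearB ?linearZ_LR /= !lextU.
    by rewrite fD -addrA -opprD subrr.
  by rewrite fZ scalerN subrr.
by exists F => s; rewrite FE /= lextU.
Qed.

Lemma multilinear_catl (W : lmodType K) (f : seq g -> W) s :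
  multilinear f -> multilinear (fun t => f (s ++ t)).
Proof. by move=> [fD fZ]; split=> *; rewrite !catA ?fD ?fZ. Qed.

Lemma multilinear_catr (W : lmodType K) (f : seq g -> W) t :
  multilinear f -> multilinear (fun s => f (s ++ t)).
Proof. by move=> [fD fZ]; split=> *; rewrite -!catA /= ?fD ?fZ. Qed.

Definition tcatl s : {linear talg -> talg} :=
  sval (cid (talg_lift (multilinear_catl s tword_multilinear))).

Lemma tcatl_word s t : tcatl s (tword t) = tword (s ++ t).
Proof. exact: svalP (cid (talg_lift (multilinear_catl s tword_multilinear))) t. Qed.

Lemma tcatl_multilinear y : multilinear (fun s => tcatl s y).
Proof.
split=> [s t a b|s t c a].
  apply: (eq_talg (h := tcatl (s ++ a :: t) \+ tcatl (s ++ b :: t))) => u /=.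
  by rewrite !tcatl_word (multilinear_catr u tword_multilinear).1.
apply: (eq_talg (h := c \*: tcatl (s ++ a :: t))) => u /=.
by rewrite !tcatl_word (multilinear_catr u tword_multilinear).2.
Qed.

Definition tcatr y : {linear talg -> talg} := sval (cid (talg_lift (tcatl_multilinear y))).

Lemma tcatr_word y s : tcatr y (tword s) = tcatl s y.
Proof. exact: svalP (cid (talg_lift (tcatl_multilinear y))) s. Qed.

Definition tcat x y := tcatr y x.

Lemma tcat_word s t : tcat (tword s) (tword t) = tword (s ++ t).
Proof. by rewrite /tcat tcatr_word tcatl_word. Qed.

Lemma tcat_bilinear : bilinear_map tcat.
Proof.
split=> [y|x c y y']; first exact: linearP.
apply: (eq_talg (f := tcatr (c *: y + y'))
  (h := (c \*: tcatr y) \+ tcatr y')) => s /=.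
by rewrite !tcatr_word linearP.
Qed.

Lemma tletter_linear : linear (fun a : g => tword [:: a]).
Proof.
have [D Z] := tword_multilinear; move=> c a b.
by rewrite (D [::] [::]) (Z [::] [::]).
Qed.
Definition tletter : {linear g -> talg} := HB.pack (fun a : g => tword [:: a])
  (GRing.isLinear.Build K g talg *:%R (fun a : g => tword [:: a]) tletter_linear).

End FullTensorAlgebra.

Section LocalityTensorAlgebra.
Variables (K : fieldType) (g : lmodType K) (T : rel g).
Hypothesis Tsym : symmetric T.
Local Notation talg := (talg g).

Lemma val_lw (s : seq g) : pairwise T s -> val (lw T s) = s.
Proof. exact: insubdK. Qed.

Lemma lw_val (s : lword T) : lw T (val s) = s.
Proof. exact: valKd. Qed.

Lemma lw_pairwise (s : lword T) : pairwise T (val s).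
Proof. exact: valP s. Qed.

(** A basis vector, under a name that hides the free module behind word_space. *)
Definition wbasis (s : seq g) : word_space T := << lw T s >>.

Definition word_emb (A : word_space T) : talg :=
  vproj (@mult_relations K g) (lext (fun s : lword T => << val s >>) A).

Lemma word_emb_linear : linear word_emb.
Proof. by move=> c A B; rewrite /word_emb lext_linear linearP. Qed.
HB.instance Definition _ :=
  GRing.isLinear.Build K (word_space T) talg *:%R word_emb word_emb_linear.

Lemma word_embU (s : lword T) : word_emb << s >> = tword (val s).
Proof. by rewrite /word_emb lextU. Qed.

Lemma word_emb_basis s : pairwise T s -> word_emb (wbasis s) = tword s.
Proof. by move=> sT; rewrite word_embU val_lw. Qed.

Lemma mult_relation_mono m n : (m <= n)%N ->
  @mult_relation K g m `<=` mult_relation n.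
Proof.
move=> mn _ [s t a b H|s t c a H]; first exact: MultD (leq_trans H mn).
exact: MultZ (leq_trans H mn).
Qed.

Lemma span_mult_relations (A : {malg K[seq g]}) :
  span (@mult_relations K g) A -> exists n, span (mult_relation n) A.
Proof.
elim=> [|c x y [n _ nx] _ [m my]]; first by exists 0%N; exact: span0.
exists (maxn n m); apply: spanD.
  by apply: mult_relation_mono nx; exact: leq_maxl.
by apply: span_mono my; apply: mult_relation_mono; exact: leq_maxr.
Qed.

(** The relations divided out are all the multilinear relations between words with
    independent letters, so the locality tensor algebra embeds in the tensor
    algebra. *)
Lemma tens_projP (A B : word_space T) :
  tens_proj T A = tens_proj T B <-> word_emb A = word_emb B.
Proof.
rewrite vproj_eq /word_emb vproj_eq -linearB; set D := A - B; split=> [|/span_mult_relations[n nD]].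
  apply: (span_image (f := lext (fun s : lword T => << val s >>))) => [|C [n _ [_ nC]]].
    exact: span_subspace.
  by apply: span_mono nC => x nx; exists n.
pose m := \max_(s <- msupp (D : {malg K[lword T]})) size (val s).
apply: span_incl; exists (maxn m n) => //; split.
  move=> s sD; rewrite leq_max; apply/orP; left; rewrite /m.
  exact: (@leq_bigmax_seq _ _ xpredT (fun s : lword T => size (val s)) s sD).
by apply: span_mono nD; apply: mult_relation_mono; exact: leq_maxr.
Qed.

Lemma word_topP (X Y : word_space T) : reflect
  (forall s t, s \in msupp (X : {malg K[lword T]}) ->
    t \in msupp (Y : {malg K[lword T]}) -> pairwise T (val s ++ val t))
  (word_top T X Y).
Proof.
apply: (iffP allrelP) => XY s t sX tY.
  by rewrite pairwise_cat XY // !lw_pairwise.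
by have := XY s t sX tY; rewrite pairwise_cat => /andP[].
Qed.

Lemma word_top_sym (X Y : word_space T) : word_top T X Y -> word_top T Y X.
Proof.
move=> /allrelP XY; apply/allrelP => s t sY tX; apply/allrelP => a b aS bT.
by rewrite Tsym; move: (XY t s tX sY) => /allrelP; apply.
Qed.

Lemma word_mul_lext (W : lmodType K) (f : {linear word_space T -> W}) (X Y : word_space T) :
  f (word_mul X Y) = lext (fun s : lword T => lext (fun t : lword T =>
    f << lw T (val s ++ val t) >>) Y) X.
Proof.
rewrite /word_mul lext_comp; apply: eq_lext => s _ /=.
by rewrite lext_comp.
Qed.

Lemma word_emb_mul (X Y : word_space T) : word_top T X Y ->
  word_emb (word_mul X Y) = tcat (word_emb X) (word_emb Y).
Proof.
move=> /word_topP XY; rewrite word_mul_lext.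
have [tl tr] := tcat_bilinear g.
pose F1 y : {linear talg -> talg} := tcatr y.
pose F2 x : {linear talg -> talg} := HB.pack (tcat x)
  (GRing.isLinear.Build K talg talg *:%R (tcat x) (tr x)).
transitivity (lext (fun s : lword T => lext (fun t : lword T =>
    tcat (tword (val s)) (tword (val t))) Y) X).
  apply: eq_lext => s sX; apply: eq_lext => t tY /=.
  by rewrite word_embU val_lw ?tcat_word //; exact: XY.
have embE Z : word_emb Z = lext (fun s : lword T => tword (val s)) Z.
  by rewrite /word_emb lext_comp.
rewrite !embE -[RHS]/(F1 _ _) lext_comp; apply: eq_lext => s _ /=.
by rewrite -[RHS]/(F2 _ _) lext_comp.
Qed.

Lemma tens_top_proj (X Y : word_space T) : word_top T X Y ->
  tens_top T (tens_proj T X) (tens_proj T Y).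
Proof. by move=> XY; apply/asboolP; exists X, Y. Qed.

(** The product does not depend on the related representatives, because it is the
    restriction of the bilinear product of the whole tensor algebra. *)
Lemma tens_mulE (X Y : word_space T) : word_top T X Y ->
  tens_mul (tens_proj T X) (tens_proj T Y) = tens_proj T (word_mul X Y).
Proof.
move=> XY; have [X' [Y' [/tens_projP eX /tens_projP eY XY' e]]] :=
  induced_mulP (@word_mul K g T) (tens_top_proj XY).
rewrite [LHS]e; apply: (tens_projP _ _).2.
have E := congr2 (@tcat K g) eX eY.
exact: etrans (word_emb_mul XY') (etrans E (esym (word_emb_mul XY))).
Qed.

Section Envelope.
Variable br : g -> g -> g.
Hypothesis br_top : forall x y z, T x y -> T x z -> T y z -> T (br x y) z.

Definition env_word (A : word_space T) : envelope T br :=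
  env_proj T br (tens_proj T A).

Lemma env_word_linear : linear env_word.
Proof. by move=> c A B; rewrite /env_word !linearP. Qed.
HB.instance Definition _ :=
  GRing.isLinear.Build K (word_space T) (envelope T br) *:%R env_word env_word_linear.

Lemma Jideal_ideal : locality_ideal (tens_top T) (@tens_mul K g T) (Jideal T br).
Proof.
split=> [|x a Jx xa].
  split=> [I [[I0 _] _] _ //|c x y Jx Jy I II SI].
  by apply: II.1.2; [apply: Jx | apply: Jy].
by split=> I II SI; case: (II.2 x a (Jx I II SI) xa).
Qed.

Lemma env_word0 X : env_word X = 0 <-> Jideal T br (tens_proj T X).
Proof.
rewrite /env_word vproj_eq0; split; last exact: span_incl.
exact: span_id Jideal_ideal.1.
Qed.

Lemma env_word_mul0 X Y : word_top T X Y -> env_word X = 0 ->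
  env_word (word_mul X Y) = 0 /\ env_word (word_mul Y X) = 0.
Proof.
move=> XY /env_word0 JX; have YX := word_top_sym XY.
have [JXY JYX] := Jideal_ideal.2 _ _ JX (tens_top_proj XY).
by split; apply/env_word0; rewrite -tens_mulE.
Qed.

Lemma env_relP (x y : envelope T br) : env_top x y <-> exists X Y,
  [/\ env_word X = x, env_word Y = y & word_top T X Y].
Proof.
split=> [/asboolP [a [b [ax bY /asboolP [X [Y [Xa Yb XY]]]]]]|[X [Y [<- <- XY]]]].
  by exists X, Y; rewrite /env_word Xa Yb; split.
by apply/asboolP; exists (tens_proj T X), (tens_proj T Y); split=> //; exact: tens_top_proj.
Qed.

Lemma env_mulP (x y : envelope T br) : env_top x y -> exists X Y,
  [/\ env_word X = x, env_word Y = y, word_top T X Y &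
      env_mul x y = env_word (word_mul X Y)].
Proof.
move=> /(induced_mulP (@tens_mul K g T)) [a [b [ax bY /asboolP [X [Y [Xa Yb XY]]] e]]].
have E := tens_mulE XY; rewrite Xa Yb in E.
exists X, Y; split; [by rewrite /env_word Xa | by rewrite /env_word Yb | exact: XY |].
by rewrite /env_word -E; exact e.
Qed.

Definition uword s : envelope T br := env_word (wbasis s).

Lemma uword_val (s : lword T) : uword (val s) = env_word << s >>.
Proof. by rewrite /uword /wbasis lw_val. Qed.

Lemma env_word_gen a b : T a b ->
  env_word (wbasis [:: a; b] - wbasis [:: b; a] - wbasis [:: br a b]) = 0.
Proof.
by move=> Tab; apply/env_word0 => I II; apply; exists a, b; rewrite !linearB.
Qed.

Lemma msupp_basis (s : seq g) (t : lword T) :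
  t \in msupp (wbasis s : {malg K[lword T]}) -> t = lw T s.
Proof. by move/(fsubsetP msuppU_le); rewrite in_fset1 => /eqP. Qed.

Lemma word_mul_basis (s t : seq g) : pairwise T (s ++ t) ->
  word_mul (wbasis s) (wbasis t) = wbasis (s ++ t).
Proof.
rewrite pairwise_cat => /and3P[_ ss tt].
by rewrite /word_mul lextU lextU !val_lw.
Qed.

Lemma word_mulB3 (A B C Y : word_space T) :
  word_mul (A - B - C) Y = word_mul A Y - word_mul B Y - word_mul C Y.
Proof. by rewrite /word_mul !linearB. Qed.

Lemma env_wordB3 A B C : env_word (A - B - C) = 0 ->
  env_word A = env_word B + env_word C.
Proof.
by move/eqP; rewrite !linearB subr_eq0 subr_eq => /eqP; rewrite addrC.
Qed.

(** The defining relation of J for a and b, multiplied on the right by t. *)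
Lemma uword_swap a b t : pairwise T [:: a, b & t] ->
  uword [:: a, b & t] = uword [:: b, a & t] + uword (br a b :: t).
Proof.
move=> abt; have := abt; rewrite /= => /and3P[/andP[Tab aT] bT tT].
have Tba : T b a by rewrite Tsym.
have bat : pairwise T [:: b, a & t] by rewrite /= Tba bT aT tT.
have cT : all (T (br a b)) t.
  by apply/allP => z zt; apply: br_top => //; [apply: (allP aT) | apply: (allP bT)].
have ct : pairwise T (br a b :: t) by rewrite /= cT tT.
pose R := wbasis [:: a; b] - wbasis [:: b; a] - wbasis [:: br a b].
have RT : word_top T R (wbasis t).
  apply/allrelP => s t' sR /msupp_basis ->; rewrite val_lw //.
  have {}sR : [\/ s = lw T [:: a; b], s = lw T [:: b; a] | s = lw T [:: br a b]].
    move/(fsubsetP (msuppB_le _ _)): sR; rewrite in_fsetU => /orP[|/msupp_basis ->].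
      move/(fsubsetP (msuppB_le _ _)); rewrite in_fsetU => /orP[] /msupp_basis ->.
        exact: Or31.
      exact: Or32.
    exact: Or33.
  by case: sR => ->; rewrite val_lw /allrel /= ?Tab ?Tba ?aT ?bT ?cT.
have [R0 _] := env_word_mul0 RT (env_word_gen Tab).
have E := f_equal3 (fun x y z => x - y - z) (@word_mul_basis [:: a; b] t abt)
  (@word_mul_basis [:: b; a] t bat) (@word_mul_basis [:: br a b] t ct).
by apply: env_wordB3; apply: etrans (congr1 env_word (esym E)) _; rewrite -word_mulB3.
Qed.

End Envelope.
End LocalityTensorAlgebra.

(** * Congruence of words in the envelope *)

Section LocalityEnvelope.
Variables (K : fieldType) (g : lmodType K) (T : rel g) (br : g -> g -> g).
Hypothesis Tsym : symmetric T.
Hypothesis br_top : forall x y z, T x y -> T x z -> T y z -> T (br x y) z.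
Local Notation talg := (talg g).
Local Notation env_word := (env_word br).
Local Notation uword := (@uword K g T br).

Lemma env_rho : exists rho : {linear talg -> envelope T br},
  forall X : word_space T, rho (word_emb X) = env_word X.
Proof.
pose b (s : lword T) := tword (val s).
have bE X : word_emb X = lext b X by rewrite /word_emb vproj_words lext_comp;
  apply: eq_lext => s _; rewrite /= lextU.
pose c (s : lword T) : envelope T br := env_word << s >>.
have cE X : env_word X = lext c X.
  apply: (eq_linear_malg (f := env_word) (g := lext c)) => s _ /=.
  by rewrite lextU.
have [|rho rhoE] := @linear_extension K _ _ _ setT b c.
  move=> A _; rewrite -bE -cE -(linear0 (@word_emb K g T)) => /tens_projP A0.
  by rewrite /env_word A0 linear0 linear0.
exists rho => X; rewrite bE cE lext_comp; apply: eq_lext => s _; exact: rhoE.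
Qed.

(** A linear map on the whole tensor algebra that extends the projection of the
    locality tensor algebra onto the envelope; its values off the words with
    independent letters are arbitrary. *)
Definition rho : {linear talg -> envelope T br} := sval (cid env_rho).

Lemma rhoE (X : word_space T) : rho (word_emb X) = env_word X.
Proof. exact: svalP (cid env_rho) X. Qed.

Lemma rho_word s : pairwise T s -> rho (tword s) = uword s.
Proof. by move=> sT; rewrite -(word_emb_basis sT) rhoE. Qed.

(** P will be the polar of a set: words are kept inside polars so that they can
    still be multiplied by letters chosen earlier. *)
Definition wset (P : set g) n : set (seq g) :=
  [set s | [/\ pairwise T s, forall a, a \in s -> P a & (size s < n)%N]].

Definition wspan P n : set talg := span [set tword s | s in wset P n].

(** Congruence to zero in the envelope modulo short words.  The short words are
    again required to have letters in P: without this a congruence could not be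
    multiplied by a letter. *)
Definition wcong P n : set talg := [set t | exists2 t', wspan P n t' & rho t = rho t'].

Lemma wspan_subspace P n : subspace (wspan P n).
Proof. exact: span_subspace. Qed.

Lemma wspan_word P n s : wset P n s -> wspan P n (tword s).
Proof. by move=> Ps; apply: span_incl; exists s. Qed.

Lemma wspan_sub P P' n n' : P `<=` P' -> (n <= n')%N -> wspan P n `<=` wspan P' n'.
Proof.
move=> PP' nn'; apply: span_mono => _ [s [sT sP sn] <-]; exists s => //.
by split=> // [a /sP /PP' //|]; exact: leq_trans sn nn'.
Qed.

Lemma wspan_repr P n t : wspan P n t -> exists X : word_space T, word_emb X = t /\
  forall s, s \in msupp (X : {malg K[lword T]}) -> forall a, a \in val s -> P a.
Proof.
elim=> [|c _ y [s [sT sP _] <-] _ [Y [<- YP]]].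
  by exists 0; split=> [|s]; rewrite ?linear0 // msupp0 inE.
exists (c *: wbasis T s + Y); split; first by rewrite word_emb_linear word_emb_basis.
move: YP; apply: (@msupp_subspace K (lword T) (fun s => forall a, a \in val s -> P a)).2.
by move=> s' /msupp_basis ->; rewrite val_lw.
Qed.

Lemma wcong_subspace P n : subspace (wcong P n).
Proof.
split=> [|c x y [x' Px' ex] [y' Py' ey]]; first by exists 0 => //; exact: span0.
exists (c *: x' + y'); first exact: (wspan_subspace P n).2.
by rewrite !linearP ex ey.
Qed.

Lemma tcat0l (y : talg) : tcat 0 y = 0.
Proof. by rewrite /tcat linear0. Qed.

Lemma tcat_linearr x : linear (@tcat K g x).
Proof. exact: (tcat_bilinear g).2. Qed.
HB.instance Definition _ x :=
  GRing.isLinear.Build K talg talg *:%R (@tcat K g x) (tcat_linearr x).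

Lemma tcat0r (x : talg) : tcat x 0 = 0.
Proof. exact: linear0. Qed.

Lemma wspan_cons P n x t : P x -> wspan (P `&` [set y | T x y]) n t ->
  wspan P n.+1 (tcat (tword [:: x]) t).
Proof.
move=> Px; apply: span_image => [|_ [s [sT sP sn] <-]]; first exact: wspan_subspace.
rewrite /= tcat_word; apply: wspan_word; split=> //=.
- by rewrite sT andbT; apply/allP => a /sP [].
- by move=> a; rewrite inE => /orP[/eqP -> //|/sP []].
Qed.

(** J is closed under products with x, as x is independent of the letters of t. *)
Lemma rho_cons0 x n t : wspan [set y | T x y] n t -> rho t = 0 ->
  rho (tcat (tword [:: x]) t) = 0.
Proof.
move=> /wspan_repr [X [<- XP]]; rewrite rhoE => X0.
have XT : word_top T X (wbasis T [:: x]).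
  apply/allrelP => s s' sX /msupp_basis ->; rewrite val_lw //.
  by apply/allrelP => a b /(XP s sX) xa; rewrite inE => /eqP ->; rewrite Tsym.
have [_ Xx] := env_word_mul0 Tsym XT X0.
by rewrite -(@word_emb_basis K g T [:: x]) // -word_emb_mul ?rhoE //; exact: word_top_sym.
Qed.

Lemma wcong_cons P m n x t : P x -> wspan (P `&` [set y | T x y]) m t ->
  wcong (P `&` [set y | T x y]) n t -> wcong P n.+1 (tcat (tword [:: x]) t).
Proof.
move=> Px Pt [t' Pt' tt']; exists (tcat (tword [:: x]) t'); first exact: wspan_cons.
apply/eqP; rewrite -subr_eq0 -!linearB; apply/eqP.
apply: (@rho_cons0 _ (maxn m n)); last by rewrite linearB tt' subrr.
have sub : P `&` [set y | T x y] `<=` [set y | T x y] by exact: subIsetr.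
apply: subspaceB; first exact: wspan_subspace.
  by apply: wspan_sub Pt => //; exact: leq_maxl.
by apply: wspan_sub Pt' => //; exact: leq_maxr.
Qed.

Definition br_closed (P : set g) : Prop :=
  forall x y, P x -> P y -> T x y -> P (br x y).

Lemma br_closedI P x : br_closed P -> br_closed (P `&` [set y | T x y]).
Proof.
move=> Pbr a b [Pa /= xa] [Pb /= xb] ab; split=> /=; first exact: Pbr.
by rewrite Tsym; apply: br_top; rewrite // Tsym.
Qed.

(** Moving x past one letter costs a word in which the two letters are replaced by
    their bracket, hence a shorter one. *)
Lemma wcong_move P s1 x s2 : br_closed P -> wset P (size (s1 ++ x :: s2)).+1 (s1 ++ x :: s2) ->
  wcong P (size (s1 ++ x :: s2)) (tword (x :: s1 ++ s2) - tword (s1 ++ x :: s2)).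
Proof.
elim: s1 P => [|y s1 IH] P Pbr [sT sP _].
  by rewrite subrr; apply: subspace0; exact: wcong_subspace.
have Py : P y by apply: sP; rewrite inE eqxx.
have Px : P x by apply: sP; rewrite inE mem_cat inE eqxx !orbT.
have [yT s1T] : all (T y) (s1 ++ x :: s2) /\ pairwise T (s1 ++ x :: s2).
  by move: sT => /= /andP[].
have s12P a : a \in s1 ++ s2 -> P a.
  by move=> as12; apply: sP; move: as12; rewrite inE !mem_cat inE => /orP[] ->;
    rewrite !orbT.
have [Tyx ys] : T y x /\ all (T y) (s1 ++ s2).
  by move: yT; rewrite !all_cat /= => /and3P[-> -> ->].
have [xs s12T] : all (T x) (s1 ++ s2) /\ pairwise T (s1 ++ s2).
  move: s1T; rewrite !pairwise_cat /= allrel_consr => /and3P[/andP[xs1 ->] -> /andP[xs2 ->]].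
  rewrite all_cat xs2 andbT; split=> //; apply/allP => a /(allP xs1).
  by rewrite Tsym.
set r := s1 ++ s2 in s12P ys xs s12T *.
have sr : size (s1 ++ x :: s2) = (size r).+1 by rewrite /r !size_cat addnS.
have xyrT : pairwise T [:: x, y & r] by rewrite /= Tsym Tyx xs ys s12T.
have e : tword (x :: y :: r) - tword (y :: s1 ++ x :: s2) =
    (tword [:: x, y & r] - tword [:: y, x & r]) +
    tcat (tword [:: y]) (tword (x :: r) - tword (s1 ++ x :: s2)).
  by rewrite linearB /= !tcat_word addrA subrK.
rewrite e; apply: subspaceD; first exact: wcong_subspace.
  exists (tword (br x y :: r)); last first.
    have yxrT : pairwise T [:: y, x & r] by rewrite /= Tyx ys xs s12T.
    have bT : pairwise T (br x y :: r).
      rewrite /= s12T andbT; apply/allP => z zr.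
      by apply: br_top; [rewrite Tsym | apply: (allP xs) | apply: (allP ys)].
    rewrite linearB !rho_word //.
    by rewrite (uword_swap Tsym br_top xyrT) addrAC subrr add0r.
  apply: wspan_word; split=> /=.
  - rewrite s12T andbT; apply/allP => z zr.
    by apply: br_top; [rewrite Tsym | apply: (allP xs) | apply: (allP ys)].
  - move=> a; rewrite inE => /orP[/eqP ->|]; last exact: s12P.
    by apply: Pbr; rewrite // Tsym.
  by rewrite sr.
apply: (@wcong_cons _ (size r).+2) => //.
  apply: subspaceB; first exact: wspan_subspace.
    apply: wspan_word; split=> //=; first by rewrite xs s12T.
    move=> a; rewrite inE => /orP[/eqP -> //|ar].
    by split; [apply: s12P | apply: (allP ys)].
  apply: wspan_word; split=> //=; last by rewrite sr.
  by move=> a as1; split; [apply: sP; rewrite inE as1 orbT | apply: (allP yT)].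
apply: IH; first exact: br_closedI.
by split=> // a as1; split; [apply: sP; rewrite inE as1 orbT | apply: (allP yT)].
Qed.

End LocalityEnvelope.

(** * The exponential of the first Eulerian projection *)

Section Splits.
Variable A : eqType.

(** The terms of the coproduct of a product of primitive elements: each letter
    goes to the first or to the second word. *)
Fixpoint splits (s : seq A) : seq (seq A * seq A) :=
  if s is a :: s' then
    [seq (a :: p.1, p.2) | p <- splits s'] ++ [seq (p.1, a :: p.2) | p <- splits s']
  else [:: ([::], [::])].

Lemma splits_size s p : p \in splits s -> (size p.1 + size p.2)%N = size s.
Proof.
elim: s p => [|a s IH] p /=; first by rewrite inE => /eqP ->.
by rewrite mem_cat => /orP[] /mapP [q /IH <- ->]; rewrite //= addnS.
Qed.

Lemma splits_subseq s p : p \in splits s -> subseq p.2 s.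
Proof.
elim: s p => [|a s IH] p; first by rewrite inE => /eqP ->.
rewrite mem_cat => /orP[] /mapP [q /IH qs ->] /=; last by rewrite eqxx.
exact: subseq_trans qs (subseq_cons s a).
Qed.

Lemma splits_nil1 s p : p \in splits s -> p.1 = [::] -> p.2 = s.
Proof.
elim: s p => [|a s IH] p; first by rewrite inE => /eqP ->.
by rewrite mem_cat => /orP[] /mapP [q qs ->] //= /(IH _ qs) ->.
Qed.

Lemma splits1 s p x : p \in splits s -> p.1 = [:: x] ->
  exists s1 s2, s = s1 ++ x :: s2 /\ p.2 = s1 ++ s2.
Proof.
elim: s p => [|a s IH] p; first by rewrite inE => /eqP ->.
rewrite mem_cat => /orP[] /mapP [q qs ->] /=.
  by case=> -> q0; exists [::], s; rewrite (splits_nil1 qs q0).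
by move=> /(IH _ qs) [s1 [s2 [-> ->]]]; exists (a :: s1), s2.
Qed.

Lemma splits_count s : count (fun p => size p.1 == 1%N) (splits s) = size s.
Proof.
have C0 t : count (fun p => size p.1 == 0%N) (splits t) = 1%N.
  elim: t => //= a t IH; rewrite count_cat !count_map.
  by rewrite [X in (X + _)%N](eq_count (a2 := pred0)) // count_pred0 -[RHS]IH.
elim: s => //= a s IH; rewrite count_cat !count_map.
by rewrite [X in (X + _)%N](C0 s) add1n -[in RHS]IH.
Qed.

End Splits.

Lemma sum_if_const (V : nmodType) (I : Type) (r : seq I) (P : pred I) (v : V) :
  \sum_(i <- r) (if P i then v else 0) = v *+ count P r.
Proof. by rewrite -big_mkcond big_const_seq iter_addr_0. Qed.

Section Exponential.
Variables (K : fieldType) (X : tensor_theory K) (H : lmodType K) (T : rel H).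
Local Notation "U ** V" := (tprod X U V) (at level 40, left associativity).
Local Notation "u <*> v" := (tpure X u v) (at level 40, left associativity).
Local Notation "f <**> g" := (tmapX X f g) (at level 40, left associativity).
Variables (mu : {linear H ** H -> H}) (e : H) (Dl : {linear H -> H ** H}).
Variable eps : {linear H -> K^o}.
Hypothesis hH : locality_bialgebra_model T mu e Dl eps.
Hypothesis natK : forall n, n.+1%:R != 0 :> K.
Variable G : nat -> set H.
Hypothesis Gsum : forall x, exists N f,
  (forall n, G n (f n)) /\ x = \sum_(n < N) f n.
Hypothesis G0 : forall x, G 0%N x -> exists c : K, x = c *: e.
Hypothesis Gcop : forall n x, G n x -> span [set t | exists p q a b,
  [/\ (p + q = n)%N, G p a, G q b & t = a <*> b]] (Dl x).
Local Notation euler := (euler hH natK Gsum G0 Gcop).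
Let Tsym := lb_sym hH.

Variables (g : lmodType K) (iota : {linear g -> H}) (br : g -> g -> g).
Hypothesis iota_inj : injective iota.
Hypothesis iota_prim : forall a, Dl (iota a) = iota a <*> e + e <*> iota a.
Hypothesis prim_iota : forall x, Dl x = x <*> e + e <*> x -> exists a, iota a = x.
Let Tg : rel g := fun a b => T (iota a) (iota b).
Hypothesis brE : forall a b, Tg a b ->
  iota (br a b) = mu (iota a <*> iota b) - mu (iota b <*> iota a).

Lemma Tg_sym : symmetric Tg.
Proof. by move=> a b; exact: Tsym. Qed.

Lemma iota_br_top a b x : Tg a b -> T (iota a) x -> T (iota b) x -> T (iota (br a b)) x.
Proof.
move=> ab ax bx; apply/polar1; rewrite brE //.
apply: (subspaceB (S := polar T [set x])); first exact: lb_polar hH [set x].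
  by apply/polar1; apply: (lb_topM hH).
by apply/polar1; apply: (lb_topM hH) => //; rewrite Tsym.
Qed.

Lemma br_top a b c : Tg a b -> Tg a c -> Tg b c -> Tg (br a b) c.
Proof. exact: iota_br_top. Qed.

Lemma euler1_lift x : exists a, iota a = euler 1 x.
Proof. exact/prim_iota/euler1_primitive. Qed.

Definition e1 (x : H) : g := sval (cid (euler1_lift x)).

Lemma iota_e1 x : iota (e1 x) = euler 1 x.
Proof. exact: svalP (cid (euler1_lift x)). Qed.

Lemma e1_linear : linear e1.
Proof. by move=> c x y; apply: iota_inj; rewrite linearP !iota_e1 linearP. Qed.
HB.instance Definition _ := GRing.isLinear.Build K H g *:%R e1 e1_linear.

Lemma e1_iota a : e1 (iota a) = a.
Proof. by apply: iota_inj; rewrite iota_e1 euler1_id //; exact: iota_prim. Qed.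

Lemma e1_one : e1 e = 0.
Proof. by apply: iota_inj; rewrite iota_e1 euler1_one linear0. Qed.

Fixpoint prodw (s : seq g) : H := if s is a :: s' then mu (iota a <*> prodw s') else e.

Lemma prodw_multilinear : multilinear prodw.
Proof.
split=> [s t a b|s t c a]; elim: s => [|x s /= ->].
- exact: (linearD (mu \o tpurel X (prodw t) \o iota)).
- exact: (linearD (mu \o tpurer X (iota x))).
- exact: (linearZ_LR (mu \o tpurel X (prodw t) \o iota)).
exact: (linearZ_LR (mu \o tpurer X (iota x))).
Qed.

Definition pi : {linear talg g -> H} := sval (cid (talg_lift prodw_multilinear)).

Lemma pi_word s : pi (tword s) = prodw s.
Proof. exact: svalP (cid (talg_lift prodw_multilinear)) s. Qed.

Lemma pi_cons a t : pi (tcat (tword [:: a]) t) = mu (iota a <*> pi t).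
Proof.
apply: (eq_talg (f := pi \o @tcat K g (tword [:: a]))
  (h := mu \o tpurer X (iota a) \o pi)) => s /=.
by rewrite tcat_word !pi_word.
Qed.

Definition tcatX : {linear talg g ** talg g -> talg g} := tfactor X (tcat_bilinear g).

Lemma tcatX_pure x y : tcatX (x <*> y) = tcat x y.
Proof. exact: tfactor_pure. Qed.

Lemma theta0_linear : linear (fun x => (eps x : K) *: tword ([::] : seq g)).
Proof. by move=> c x y; rewrite linearP scalerDl scalerA. Qed.
Definition theta0 : {linear H -> talg g} :=
  HB.pack (fun x => (eps x : K) *: tword ([::] : seq g))
    (GRing.isLinear.Build K H (talg g) *:%R _ theta0_linear).

(** The components of the convolution exponential of e1 in the tensor algebra. *)
Fixpoint theta n : {linear H -> talg g} :=
  if n is n'.+1 then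
    n'.+1%:R^-1 \*: (tcatX \o ((@tletter K g \o e1) <**> theta n') \o Dl)
  else theta0.

Definition thetaT n : {linear H ** H -> talg g} :=
  tcatX \o ((@tletter K g \o e1) <**> theta n).

Lemma thetaS n x : theta n.+1 x = n.+1%:R^-1 *: thetaT n (Dl x).
Proof. by []. Qed.

Lemma thetaT_pure n a b : thetaT n (a <*> b) = tcat (tword [:: e1 a]) (theta n b).
Proof. by rewrite [LHS]/= tmapX_pure tcatX_pure. Qed.

Definition plett (U : set H) : set g := [set a | polar T U (iota a)].

Lemma plettI U x : plett U `&` [set y | Tg x y] = plett (U `|` [set iota x]).
Proof.
apply/seteqP; split=> [y [Uy xy] z [/Uy //|->]|y Uy]; first by rewrite Tsym.
by split=> [z Uz|]; [apply: Uy; left | rewrite /= /Tg Tsym; apply: Uy; right].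
Qed.

(** In a term a x b of the coproduct, b is independent of a and hence of e1 a.  So
    by induction, applied to U enlarged by e1 a, the letters that come from b are
    independent of e1 a. *)
Lemma theta_wspan U n x : polar T U x -> wspan Tg (plett U) n.+1 (theta n x).
Proof.
elim: n U x => [|n IH] U x Ux.
  by apply: subspaceZ; [exact: wspan_subspace | apply: wspan_word].
rewrite thetaS; apply: subspaceZ; first exact: wspan_subspace.
apply: span_image (lb_cop_top hH Ux) => [|_ [a [b [Ua Ub Tab ->]]]].
  exact: wspan_subspace.
have aT := @top_stable_euler _ _ _ _ _ _ _ _ hH natK _ Gsum G0 Gcop 1.
rewrite thetaT_pure; apply: wspan_cons.
  by rewrite /plett /= iota_e1; apply: top_stable_polar Ua; exact: aT.
rewrite plettI; apply: IH => z [/Ub //|->].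
by rewrite iota_e1 Tsym; exact: aT.
Qed.

(** The components of the exponential become the euler n after multiplication,
    because both satisfy the recursion euler_rec. *)
Lemma pi_theta n x : pi (theta n x) = euler n x.
Proof.
elim: n x => [|n IH] x.
  by rewrite /= linearZ_LR /= pi_word euler0.
rewrite thetaS linearZ_LR /=; apply: (canLR (scalerK (natK n))).
rewrite euler_rec.
apply: (eq_tprod (f := pi \o thetaT n) (g := mu \o (euler 1 <**> euler n))) => a b.
by rewrite -[LHS]/(pi (thetaT n (a <*> b))) thetaT_pure pi_cons iota_e1 IH /= tmapX_pure.
Qed.

(** Each letter takes up a positive degree, since e1 kills degree 0. *)
Lemma theta_homogeneous d x n : G d x -> (d < n)%N -> theta n x = 0.
Proof.
elim: n d x => // n IH d x Gx dn; rewrite thetaS.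
suff -> : thetaT n (Dl x) = 0 by rewrite scaler0.
apply: (eq_linear_span (f := thetaT n) (g := \0)) (Gcop Gx).
move=> _ [p [q [a [b [pq Ga Gb ->]]]]]; rewrite thetaT_pure.
case: p pq Ga => [|p] pq Ga.
  have -> : e1 a = 0 by have [c ->] := G0 Ga; rewrite linearZ_LR /= e1_one scaler0.
  have -> : tword [:: 0] = 0 := linear0 (@tletter K g).
  exact: tcat0l.
have -> : theta n b = 0.
  by apply: IH Gb _; rewrite -ltnS (leq_trans _ dn) // -pq addSn !ltnS leq_addl.
exact: tcat0r.
Qed.

Lemma theta_finite x : exists N, forall n, (N <= n)%N -> theta n x = 0.
Proof.
have [N [f [Gf ->]]] := Gsum x; exists N => n Nn.
rewrite linear_sum big1 // => d _; apply: theta_homogeneous (Gf d) _.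
exact: leq_trans (ltn_ord d) Nn.
Qed.

Definition Theta (x : H) : talg g := \sum_(n < sval (cid (theta_finite x))) theta n x.

Lemma ThetaE x : exists N, forall M, (N <= M)%N -> Theta x = \sum_(n < M) theta n x.
Proof.
exists (sval (cid (theta_finite x))) => M NM; rewrite /Theta.
rewrite (big_ord_widen M (fun n => theta n x)) // big_mkcond; apply: eq_bigr => n _.
by case: ifP => // /negbT; rewrite -leqNgt => /(svalP (cid (theta_finite x))).
Qed.

Lemma Theta_linear : linear Theta.
Proof.
move=> c x y; have [N xN] := ThetaE x; have [M yM] := ThetaE y.
have [L xyL] := ThetaE (c *: x + y); pose m := maxn L (maxn N M).
have Lm : (L <= m)%N by rewrite leq_maxl.
have Nm : (N <= m)%N by rewrite !leq_max leqnn orbT.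
have Mm : (M <= m)%N by rewrite !leq_max leqnn !orbT.
rewrite (xyL m Lm) (xN m Nm) (yM m Mm).
by rewrite scaler_sumr -big_split; apply: eq_bigr => n _; rewrite linearP.
Qed.
HB.instance Definition _ := GRing.isLinear.Build K H (talg g) *:%R Theta Theta_linear.

Lemma Theta_wspan U x : polar T U x -> exists n, wspan Tg (plett U) n (Theta x).
Proof.
move=> Ux; exists (sval (cid (theta_finite x))).
apply: subspace_sum => [|n _]; first exact: wspan_subspace.
by apply: wspan_sub (theta_wspan n Ux) => //; exact: ltn_ord.
Qed.

Lemma pi_Theta x : pi (Theta x) = x.
Proof.
have [N xN] := ThetaE x.
have [M xM] := @euler_sum _ _ _ _ _ _ _ _ hH natK _ Gsum G0 Gcop x.
rewrite (xN (maxn N M)) ?leq_maxl // linear_sum [RHS](xM (maxn N M)) ?leq_maxr //.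
by apply: eq_bigr => n _; exact: pi_theta.
Qed.

Lemma prodw_top s x : pairwise Tg s -> (forall a, a \in s -> T (iota a) x) ->
  T (prodw s) x.
Proof.
elim: s x => [|a s IH] x /=; first by move=> _ _; exact: lb_top1 hH x.
move=> /andP[/allP aS sT] sx; apply: (lb_topM hH).
- rewrite Tsym; apply: IH => // b bs; rewrite Tsym; exact: aS.
- by apply: sx; rewrite inE eqxx.
by apply: IH => // b bs; apply: sx; rewrite inE bs orbT.
Qed.

Lemma prodw_cat s t : pairwise Tg (s ++ t) ->
  prodw (s ++ t) = mu (prodw s <*> prodw t).
Proof.
elim: s => [|a s IH] /=; first by rewrite (lb_mul1x hH).
rewrite all_cat pairwise_cat => /andP[/andP[/allP aS /allP aT] /and3P[st sS tT]].
rewrite IH ?pairwise_cat ?st ?sS // (lb_mulA hH) //.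
- by rewrite Tsym; apply: prodw_top => // b bs; rewrite Tsym; exact: aS.
- by rewrite Tsym; apply: prodw_top => // b bt; rewrite Tsym; exact: aT.
apply: prodw_top => // b bs; rewrite Tsym; apply: prodw_top => // c ct.
by rewrite Tsym; move/allrelP: st; apply.
Qed.

Lemma pi_word_mul (A B : word_space Tg) : word_top Tg A B ->
  pi (word_emb (word_mul A B)) = mu (pi (word_emb A) <*> pi (word_emb B)).
Proof.
move=> /word_topP AB.
have piE C : pi (word_emb C) = lext (fun s : lword Tg => prodw (val s)) C.
  apply: (eq_linear_malg (f := pi \o @word_emb K g Tg)
    (g := lext (fun s : lword Tg => prodw (val s)))) => s _.
  by rewrite [LHS]/= word_embU pi_word /= lextU.
rewrite -[LHS]/((pi \o @word_emb K g Tg) _) word_mul_lext.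
transitivity (lext (fun s : lword Tg => lext (fun t : lword Tg =>
    mu (prodw (val s) <*> prodw (val t))) B) A).
  apply: eq_lext => s sA; apply: eq_lext => t tB.
  by rewrite [LHS]/= word_embU pi_word val_lw ?prodw_cat //; exact: AB.
rewrite !piE -[RHS]/((mu \o tpurel X _) _) lext_comp; apply: eq_lext => s _ /=.
by rewrite -[RHS]/((mu \o tpurer X _) _) lext_comp.
Qed.

Local Notation env_word := (@env_word K g Tg br).

(** The map pi is multiplicative on related words, so its kernel on the locality
    tensor algebra is a locality ideal, which contains the relations of J. *)
Lemma env_psi : exists psi : {linear envelope Tg br -> H},
  forall A, psi (env_word A) = pi (word_emb A).
Proof.
have [|psiT psiTE] := @vquot_lift K _ _ (\bigcup_n Imult_local Tg n)
    (pi \o @word_emb K g Tg).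
  move=> A IA; have /tens_projP A0 : tens_proj Tg A = tens_proj Tg 0.
    by rewrite linear0; apply/vproj_eq0/span_incl.
  by rewrite [LHS]/= A0 (linear0 (@word_emb K g Tg)) (linear0 pi).
have psiTp A : psiT (tens_proj Tg A) = pi (word_emb A) by exact: psiTE.
have [|psi psiE] := @vquot_lift K _ _ (Jideal Tg br) psiT; last first.
  by exists psi => A; rewrite -psiTp; exact: psiE.
move=> x /(_ [set y | psiT y = 0]); apply; last first.
  move=> _ [a [b [Tab ->]]].
  have Tba : Tg b a by rewrite Tg_sym.
  have E s : pairwise Tg s -> psiT (tens_word Tg s) = prodw s.
    by move=> sT; rewrite -pi_word -(word_emb_basis sT); exact: psiTp.
  have B3 u v w : psiT (u - v - w) = psiT u - psiT v - psiT w by rewrite !linearB.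
  apply: etrans (B3 _ _ _) _.
  have abT : pairwise Tg [:: a; b] by rewrite /= Tab.
  have baT : pairwise Tg [:: b; a] by rewrite /= Tba.
  apply: etrans (f_equal3 (fun x y z => x - y - z) (E _ abT) (E _ baT)
    (E [:: br a b] isT)) _.
  by rewrite /= !(lb_mulx1 hH) brE // subrr.
split=> [|y z y0 /asboolP [A [B [Ay Bz AB]]]].
  by split=> [|c u v /= u0 v0] /=; rewrite ?linear0 // linearP u0 v0 scaler0 addr0.
have BA := word_top_sym Tg_sym AB.
have y0' : pi (word_emb A) = 0 by rewrite -psiTp Ay.
split; rewrite /= -Ay -Bz.
  rewrite (tens_mulE AB); apply: etrans (psiTp _) _.
  rewrite (pi_word_mul AB) y0'.
  by rewrite -[LHS]/((mu \o tpurel X _) 0) linear0.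
rewrite (tens_mulE BA); apply: etrans (psiTp _) _.
rewrite (pi_word_mul BA) y0'.
by rewrite -[LHS]/((mu \o tpurer X _) 0) linear0.
Qed.

(** The map induced on the envelope by the inclusion of the primitive elements. *)
Definition psi : {linear envelope Tg br -> H} := sval (cid env_psi).

Lemma psiE A : psi (env_word A) = pi (word_emb A).
Proof. exact: svalP (cid env_psi) A. Qed.

Lemma psi_word s : pairwise Tg s -> psi (uword Tg br s) = prodw s.
Proof. by move=> sT; rewrite psiE word_emb_basis ?pi_word. Qed.

Local Notation rho := (@rho K g Tg br).

Lemma psi_rho P n t : wspan Tg P n t -> psi (rho t) = pi t.
Proof. by move=> /wspan_repr [A [<- _]]; rewrite rhoE psiE. Qed.

(** The exponential of e1 with values in the envelope. *)
Definition Phi (x : H) : envelope Tg br := rho (Theta x).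

Lemma Phi_linear : linear Phi.
Proof. by move=> c x y; rewrite /Phi !linearP. Qed.
HB.instance Definition _ :=
  GRing.isLinear.Build K H (envelope Tg br) *:%R Phi Phi_linear.

Definition Phi_map : {linear H -> envelope Tg br} := Phi.

Lemma Phi_psi : cancel Phi psi.
Proof.
move=> x; have [n xn] := Theta_wspan (polar0 T x).
by rewrite /Phi (psi_rho xn) pi_Theta.
Qed.

(** Multiplying by a primitive element puts it into one of the two tensor factors. *)
Lemma cop_prodw s : pairwise Tg s ->
  Dl (prodw s) = \sum_(p <- splits s) prodw p.1 <*> prodw p.2.
Proof.
elim: s => [_|a s IH] /=; first by rewrite big_seq1 (lb_cop1 hH).
move=> /andP[/allP aS sT].
have as_top : T (iota a) (prodw s).
  by rewrite Tsym; apply: prodw_top => // b bs; rewrite Tsym; exact: aS.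
rewrite (lb_copM hH as_top) IH // iota_prim.
pose F : {linear H ** H -> H ** H} := (mu <**> mu) \o midswap X H H H H
  \o tpurer X (iota a <*> e + e <*> iota a).
have FE u v : F (u <*> v) = mu (iota a <*> u) <*> v + u <*> mu (iota a <*> v).
  have D := linearD (tpurel X (u <*> v)) (iota a <*> e) (e <*> iota a).
  apply: etrans (congr1 (fun t => (mu <**> mu) (midswap X H H H H t)) D) _.
  by rewrite !linearD !midswap_pure !tmapX_pure !(lb_mul1x hH).
rewrite -[LHS]/(F _) linear_sum big_cat !big_map /= -big_split /=.
by apply: eq_bigr => p _; exact: FE.
Qed.

Lemma theta_prodwS n s : pairwise Tg s -> n.+1%:R *: theta n.+1 (prodw s) =
  \sum_(p <- splits s) tcat (tword [:: e1 (prodw p.1)]) (theta n (prodw p.2)).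
Proof.
move=> sT; rewrite thetaS scalerA divff // scale1r cop_prodw // linear_sum.
by apply: eq_bigr => p _; exact: thetaT_pure.
Qed.

Lemma tcat_e1_one t : tcat (tword [:: e1 e]) t = 0.
Proof.
rewrite e1_one; have -> : tword [:: 0] = 0 := linear0 (@tletter K g).
exact: tcat0l.
Qed.

(** Each of the k factors needs a letter, because e1 kills the unit; with fewer
    letters no term of the coproduct survives. *)
Lemma theta_prodw0 k s : pairwise Tg s -> (size s < k)%N -> theta k (prodw s) = 0.
Proof.
elim: k s => // k IH s sT sk.
apply: (scalerI (natK k)); rewrite scaler0 theta_prodwS //.
rewrite big_seq; apply: big1 => p ps.
have [pk|kp] := ltnP (size p.2) k.
  have -> : theta k (prodw p.2) = 0.
    by apply: IH pk; exact: subseq_pairwise (splits_subseq ps) sT.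
  exact: tcat0r.
have /size0nil -> : size p.1 = 0%N.
  apply/eqP; rewrite -leqn0 -(leq_add2r (size p.2)) add0n (splits_size ps).
  by apply: leq_trans kp; rewrite -ltnS.
exact: tcat_e1_one.
Qed.

Lemma plett_closed U : br_closed Tg br (plett U).
Proof. by move=> a b Ua Ub ab u Uu; apply: iota_br_top; [|apply: Ua|apply: Ub]. Qed.

(** In n theta_n (x1 ... xn) only the n terms that split off a single letter
    survive: with several letters split off, too few are left for theta_(n-1), and
    with none, e1 is applied to the unit.  Each surviving term is by induction the
    word with that letter moved to the front, up to shorter words. *)
Lemma theta_prodw U s : wset Tg (plett U) (size s).+1 s ->
  wcong Tg br (plett U) (size s) (theta (size s) (prodw s) - tword s).
Proof.
have [n ns] := ubnP (size s); elim: n s U ns => // n IH [|x s] U.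
  move=> _ _; rewrite /= (lb_eps1 hH) scale1r subrr.
  exact: subspace0 (wcong_subspace _ _ _ _).
set w := x :: s; rewrite ltnS => wn wU; have wT : pairwise Tg w by case: wU.
have cS := wcong_subspace Tg br (plett U) (size w).
have -> : theta (size w) (prodw w) - tword w = (size w)%:R^-1 *: (\sum_(p <- splits w)
    (tcat (tword [:: e1 (prodw p.1)]) (theta (size s) (prodw p.2))
     - (if size p.1 == 1%N then tword w else 0))).
  rewrite sumrB -theta_prodwS // sum_if_const splits_count -scaler_nat -scalerBr.
  by rewrite scalerA (mulVf (natK (size s))) scale1r.
apply: subspaceZ => //; apply: subspace_sum_seq => // p pw.
have pT : pairwise Tg p.2 by exact: subseq_pairwise (splits_subseq pw) wT.
have sp : (size p.1 + size p.2)%N = (size s).+1 by exact: splits_size pw.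
case: (ltngtP (size p.1) 1%N) => [|p1|p1].
- rewrite ltnS leqn0 => /eqP/size0nil p1; rewrite p1 subr0.
  by rewrite /= tcat_e1_one; exact: subspace0 cS.
- rewrite (theta_prodw0 pT); last by rewrite -ltnS -sp -(add1n (size p.2)) ltn_add2r.
  by rewrite subr0 tcat0r; exact: subspace0 cS.
have [y p1E] : exists y, p.1 = [:: y] by case: (p.1) p1 => [|y [|]] // _; exists y.
have [s1 [s2 [wE p2E]]] := splits1 pw p1E.
rewrite p1E /= (lb_mulx1 hH) e1_iota.
have p2s : size p.2 = size s by move: sp; rewrite p1E add1n => -[].
have [_ wP _] := wU.
have yU : plett U y by apply: wP; rewrite wE mem_cat inE eqxx orbT.
have yT : all (Tg y) p.2.
  move: wT; rewrite wE p2E pairwise_cat /= allrel_consr all_cat.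
  move=> /and3P[/andP[s1y _] _ /andP[-> _]]; rewrite andbT.
  by apply/allP => a /(allP s1y); rewrite Tg_sym.
have p2U a : a \in p.2 -> plett (U `|` [set iota y]) a.
  rewrite -plettI => ap; split; last exact: (allP yT).
  apply: wP; rewrite wE; move: ap; rewrite p2E !mem_cat inE => /orP[] ->.
    by [].
  by rewrite !orbT.
have polp2 : polar T (U `|` [set iota y]) (prodw p.2).
  by move=> z Uz; apply: prodw_top => // a /p2U /(_ z Uz).
have E : tcat (tword [:: y]) (theta (size s) (prodw p.2)) - tword w =
    tcat (tword [:: y]) (theta (size s) (prodw p.2) - tword p.2) +
    (tword (y :: p.2) - tword w).
  by rewrite linearB /= tcat_word addrA subrK.
rewrite E; apply: subspaceD => //.
  apply: (@wcong_cons _ _ _ _ Tg_sym _ (size s).+1) => //; rewrite plettI.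
    apply: subspaceB; first exact: wspan_subspace.
      exact: theta_wspan.
    by apply: wspan_word; split=> //; rewrite p2s.
  by rewrite -p2s; apply: IH; [rewrite p2s | split].
have M := @wcong_move _ _ _ _ Tg_sym br_top (plett U) s1 y s2 (plett_closed (U := U)).
by rewrite -wE -p2E in M; exact: M.
Qed.

(** By theta_prodw, Phi (x1 ... xn) is the word x1 ... xn plus shorter words, which
    are reached by induction. *)
Lemma Phi_surj_word s : pairwise Tg s -> exists x, Phi x = uword Tg br s.
Proof.
have [n ns] := ubnP (size s); elim: n s ns => // n IH s; rewrite ltnS => sn sT.
have subP : subspace [set u | exists x, Phi x = u].
  split=> [|c u v [x xu] [y yv]]; first by exists 0; rewrite linear0.
  by exists (c *: x + y); rewrite linearP /= xu yv.
have short P t : wspan Tg P (size s) t -> exists x, Phi x = rho t.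
  apply: (span_image (f := rho) (S' := [set u | exists x, Phi x = u])) => //.
  move=> _ [w [wT _ ws] <-]; rewrite /= rho_word //; apply: IH => //.
  exact: leq_trans ws sn.
have sU : wset Tg (plett set0) (size s).+1 s by split=> // a _ u.
have [t' st' tt'] := theta_prodw sU.
have [N NE] := ThetaE (prodw s).
have PhiE : Phi (prodw s) = \sum_(k < size s) rho (theta k (prodw s)) +
    (rho t' + uword Tg br s).
  rewrite /Phi (NE (maxn N (size s).+1)) ?leq_maxl // linear_sum.
  rewrite -(big_mkord xpredT (fun k => rho (theta k (prodw s)))).
  rewrite (big_cat_nat (n := (size s).+1)) ?leq_maxr //= [X in _ + X]big_nat_cond.
  rewrite [X in _ + X]big1 ?addr0; last first.
    by move=> k /andP[/andP[sk _] _]; rewrite theta_prodw0 // linear0.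
  rewrite big_nat_recr //= big_mkord; congr (_ + _).
  by rewrite -tt' linearB rho_word // subrK.
have [x xE] : [set u | exists x, Phi x = u]
    (\sum_(k < size s) rho (theta k (prodw s)) + rho t').
  apply: (subspaceD subP); last exact: short st'.
  apply: subspace_sum subP _ => k _; apply: (short (plett set0)).
  by apply: wspan_sub (theta_wspan _ (polar0 T _)).
have ab (a b c : envelope Tg br) : a + (b + c) - (a + b) = c.
  by rewrite addrA [a + b + c]addrC addrK.
by exists (prodw s - x); rewrite linearB /= xE PhiE; exact: ab.
Qed.

(** The map Phi is onto and has the left inverse psi. *)
Lemma psi_Phi : cancel psi Phi.
Proof.
suff surj u : exists x, Phi x = u by move=> u; have [x <-] := surj u; rewrite Phi_psi.
have subP : subspace [set u | exists x, Phi x = u].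
  split=> [|c v w [x xv] [y yw]]; first by exists 0; rewrite linear0.
  by exists (c *: x + y); rewrite linearP /= xv yw.
move: u; apply: vquot_ind => t; move: t; apply: vquot_ind => A.
rewrite -[vproj _ _]/(env_word A).
apply: (malg_span (S := [set A | exists x, Phi x = env_word A])) => [|s _].
  split=> [|c B C [x xB] [y yC]]; first by exists 0; rewrite !linear0.
  by exists (c *: x + y); rewrite !linearP /= xB yC.
have [x xs] := Phi_surj_word (lw_pairwise s); exists x.
by rewrite xs; apply: uword_val.
Qed.

(** First choose letters for x independent of y; then y is independent of this
    finite set of letters, and theta_wspan gives letters for y independent of it. *)
Lemma Phi_top x y : T x y -> env_top (Phi x) (Phi y).
Proof.
move=> xy; have [n] := Theta_wspan ((polar1 T x y).2 xy).
move=> /wspan_repr [A [AE AP]].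
pose U : set H := [set z | exists2 s, s \in msupp (A : {malg K[lword Tg]}) &
  exists2 a, a \in val s & z = iota a].
have yU : polar T U y by move=> _ [s sA [a /(AP s sA) ay ->]]; rewrite Tsym; apply: ay.
have [m /wspan_repr [B [BE BP]]] := Theta_wspan yU.
apply/env_relP; exists A, B; split.
- by rewrite /Phi -AE rhoE.
- by rewrite /Phi -BE rhoE.
apply/allrelP => s t sA tB; apply/allrelP => a b aS bt.
by rewrite Tg_sym; apply: (BP t tB b bt); exists s => //; exists a.
Qed.

Lemma psi_top u v : env_top u v -> T (psi u) (psi v).
Proof.
move=> /env_relP [A [B [<- <- AB]]]; rewrite !psiE.
have half (C : word_space Tg) z : (forall s, s \in msupp (C : {malg K[lword Tg]}) ->
    T (prodw (val s)) z) -> T (pi (word_emb C)) z.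
  move=> Cz; apply/polar1.
  apply: (malg_span (S := [set C | polar T [set z] (pi (word_emb C))])) => [|s sC].
    have zS := lb_polar hH [set z].
    split=> [|c D E Dz Ez] /=; first by rewrite !linear0; exact: subspace0.
    by rewrite !linearP; apply: zS.2.
  by apply/polar1; rewrite /= word_embU pi_word; exact: Cz.
move/allrelP: AB => AB.
apply: (half A _) => s sA; rewrite Tsym; apply: (half B _) => t tB.
apply: prodw_top; first exact: lw_pairwise.
move=> b bt; rewrite Tsym; apply: prodw_top; first exact: lw_pairwise.
by move=> a aS; have /allrelP := AB s t sA tB; apply.
Qed.

Lemma psi_mul u v : env_top u v -> psi (env_mul u v) = mu (psi u <*> psi v).
Proof.
move=> /env_mulP [A [B [<- <- AB e']]].
apply: etrans (congr1 psi e') _.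
by rewrite !psiE; exact: pi_word_mul.
Qed.

Lemma psi_one : psi (env_one Tg br) = e.
Proof. exact: (psi_word (s := [::])). Qed.

Lemma psi_iota a : psi (env_iota Tg br a) = iota a.
Proof. by rewrite -[RHS](lb_mulx1 hH); exact: (psi_word (s := [:: a])). Qed.

End Exponential.

(** * Locality Hopf algebras as models *)

Section Model.
Variables (K : fieldType) (H : lmodType K) (h : hopf_ops H).
Local Notation TP := (tensor_product K).
Local Notation "u <*> v" := (tpure TP u v) (at level 40, left associativity).
Hypothesis hh : is_locality_hopf h.
Local Notation T := (ltop h).
Local Notation e := (lone h).
Let Dl : {linear H -> tprod TP H H} := lcop h.

Let A := bialg_alg (hopf_bialg hh).
Let C := bialg_coalg (hopf_bialg hh).

(** Local bilinearity is exactly what linear_extension asks of the product on the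
    family of the tensors of independent pairs. *)
Lemma locality_product : exists mu : {linear tprod TP H H -> H},
  forall a b, T a b -> mu (a <*> b) = lmul h a b.
Proof.
pose b (p : H * H) : tensor H H := tens p.1 p.2.
pose c (p : H * H) := lmul h p.1 p.2.
have [|mu muE] := @linear_extension K _ _ _ [set p | T p.1 p.2] b c.
  move=> X TX bX; apply: (alg_bilinear A) => //.
  by apply/vproj_eq0; exact: etrans (tclass_lext X) bX.
by exists mu => x y Txy; exact: (muE (x, y)).
Qed.

Lemma locality_tensor_repr (U : set H) t : indep_tensor (X := TP) T U t ->
  exists X, [/\ on_relation T X, forall p, p \in msupp X -> polar T U p.1 /\ polar T U p.2
    & tclass X = t].
Proof.
move=> Ut.
have [X [XP XE]] : exists X : {malg K[(H * H)%type]}, (forall p, p \in msupp X ->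
    [/\ polar T U p.1, polar T U p.2 & T p.1 p.2]) /\
    lext (fun p : H * H => tens p.1 p.2) X = t.
  apply: (span_lext (P := [set p : H * H | [/\ polar T U p.1, polar T U p.2 & T p.1 p.2]])).
  apply: span_mono Ut => _ [x [y [Ux Uy Txy ->]]].
  by exists (x, y).
exists X; split; first by move=> p /XP [].
  by move=> p /XP [].
by rewrite tclass_lext.
Qed.

Variable mu : {linear tprod TP H H -> H}.
Hypothesis muE : forall a b, T a b -> mu (a <*> b) = lmul h a b.

(** For the multiplicativity of the coproduct, X represents the coproduct of x
    with entries independent of y, and Y that of y with entries independent of all
    those of X. *)
Lemma locality_hopf_model : cocommutative h ->
  locality_bialgebra_model (X := TP) T mu e Dl (lcounit h).
Proof.
move=> hC.
have [Tsym T00 Tpol] := alg_space A.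
have T1 a : T e a by have := alg_unit_polar A 1 a; rewrite scale1r.
have m1 a : lmul h e a = a by have := alg_unitl A 1 a; rewrite !scale1r.
have m1' a : lmul h a e = a by have := alg_unitr A 1 a; rewrite !scale1r.
have TM a b c : T a b -> T a c -> T b c -> T (lmul h a b) c.
  by move=> ab ac bc; apply/polar1; apply: (alg_polar A) => //; apply/polar1.
have copT U x : polar T U x -> indep_tensor (X := TP) T U (Dl x).
  exact: (coalg_polar C).
split=> //.
- by move=> a b c ab ac bc; rewrite muE //; exact: TM.
- move=> a b c ab ac bc.
  have abc : T (lmul h a b) c by exact: TM.
  have a_bc : T a (lmul h b c) by rewrite Tsym; apply: TM; rewrite // Tsym.
  by rewrite (muE ab) (muE bc) (muE abc) (muE a_bc); exact: alg_assoc A _ _ _ ab ac bc abc a_bc.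
- by move=> a; rewrite muE.
- by move=> a; rewrite muE ?m1' // Tsym.
- exact: coalg_assoc C.
- move=> f fE x; rewrite -[RHS](coalg_counitl C x).
  have bl := bilinear_counitl (lcounit h).
  apply: (eq_tprod (t0 := TP) (f := f) (g := tlift_map bl)) => a b.
  by rewrite fE; exact/esym/tlift_tens.
- move=> f fE x; rewrite -[RHS](coalg_counitr C x).
  have bl : bilinear_map (fun a b : H => (lcounit h b : K) *: a).
    split=> [v|u] c a b /=; first by rewrite scalerDr !scalerA mulrC.
    by rewrite linearP scalerDl scalerA.
  apply: (eq_tprod (t0 := TP) (f := f) (g := tlift_map bl)) => a b.
  by rewrite fE; exact/esym/tlift_tens.
- move=> x y Txy.
  have [X [XT XU XE]] := locality_tensor_repr (copT _ _ ((polar1 T x y).2 Txy)).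
  pose U : set H := [set z | exists2 p, p \in msupp X & z = p.1 \/ z = p.2].
  have yU : polar T U y.
    by move=> _ [p /XU [p1 p2] [->|->]]; rewrite Tsym; [apply: p1|apply: p2].
  have [Y [YT YU YE]] := locality_tensor_repr (copT _ _ yU).
  have XY : pairs_independent T X Y.
    move=> p q pX /YU [q1 q2]; split; rewrite Tsym.
    - by apply: q1; exists p => //; left.
    - by apply: q2; exists p => //; left.
    - by apply: q1; exists p => //; right.
    by apply: q2; exists p => //; right.
  rewrite muE //.
  apply: etrans (bialg_copM (hopf_bialg hh) Txy XT YT XY XE YE) _.
  pose F : {linear tprod TP (tprod TP H H) (tprod TP H H) -> tprod TP H H} :=
    tmapX TP mu mu \o midswap TP H H H H.
  rewrite -[RHS]/(F (Dl x <*> Dl y)).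
  have -> : Dl x = lext (fun p : H * H => p.1 <*> p.2) X.
    exact: etrans (esym XE) (tclass_lext X).
  have -> : Dl y = lext (fun p : H * H => p.1 <*> p.2) Y.
    exact: etrans (esym YE) (tclass_lext Y).
  rewrite (lext_tpure F); apply: eq_lext => p pX; apply: eq_lext => q qY.
  have [T1' T2 T3 T4] := XY p q pX qY.
  rewrite -[RHS]/(tmapX TP mu mu (midswap TP H H H H (p.1 <*> p.2 <*> (q.1 <*> q.2)))).
  by rewrite midswap_pure tmapX_pure (muE T1') (muE T4).
- exact: bialg_cop1 (hopf_bialg hh).
exact: bialg_counit1 (hopf_bialg hh).
Qed.

Lemma antip_mull x : mu (tmapX TP (lantip h) idfun (Dl x)) = (lcounit h x : K) *: e.
Proof.
have [Tsym T00 Tpol] := alg_space A.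
have [X [XT _ XE]] := locality_tensor_repr (coalg_polar C (polar0 T x)).
rewrite -(hopf_antipl hh XT XE).
have -> : Dl x = lext (fun p : H * H => p.1 <*> p.2) X.
  exact: etrans (esym XE) (tclass_lext X).
rewrite (tmapX_lext mu); apply: eq_lext => p pX; rewrite muE //.
exact: (hopf_antip_independent hh) (XT p pX).
Qed.

Lemma antip_mulr x : mu (tmapX TP idfun (lantip h) (Dl x)) = (lcounit h x : K) *: e.
Proof.
have [Tsym T00 Tpol] := alg_space A.
have [X [XT _ XE]] := locality_tensor_repr (coalg_polar C (polar0 T x)).
rewrite -(hopf_antipr hh XT XE).
have -> : Dl x = lext (fun p : H * H => p.1 <*> p.2) X.
  exact: etrans (esym XE) (tclass_lext X).
rewrite (tmapX_lext mu); apply: eq_lext => p pX; rewrite muE //.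
rewrite Tsym; apply: (hopf_antip_independent hh).
by have := XT p pX; rewrite Tsym.
Qed.

Lemma antip_primitive p : cocommutative h ->
  lcop h p = p <*> e + e <*> p -> lantip h p = - p.
Proof.
move=> /locality_hopf_model hb pP.
have Se : lantip h e = e.
  have := antip_mull e; rewrite [Dl e](lb_cop1 hb) tmapX_pure (lb_mulx1 hb).
  by rewrite (lb_eps1 hb) scale1r.
have := antip_mull p; rewrite [Dl p]pP (counit_primitive hb pP) scale0r.
rewrite !linearD !tmapX_pure Se (lb_mulx1 hb) (lb_mul1x hb) => /eqP.
by rewrite addr_eq0 => /eqP.
Qed.

End Model.

(** * Transport of structure *)

Section TransportCoproduct.
Variables (K : fieldType) (X : tensor_theory K) (V W : lmodType K).
Local Notation "U ** V" := (tprod X U V) (at level 40, left associativity).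
Local Notation "u <*> v" := (tpure X u v) (at level 40, left associativity).
Local Notation "f <**> g" := (tmapX X f g) (at level 40, left associativity).

Lemma tassocX_map (A B C A' B' C' : lmodType K) (f : {linear A -> A'})
    (g : {linear B -> B'}) (h : {linear C -> C'}) t :
  tassocX X A' B' C' (((f <**> g) <**> h) t) = (f <**> (g <**> h)) (tassocX X A B C t).
Proof.
apply: (eq_tprod3 (f := tassocX X A' B' C' \o ((f <**> g) <**> h))
  (g := (f <**> (g <**> h)) \o tassocX X A B C)) => a b c.
by rewrite [LHS]/= [RHS]/= tassocX_pure !tmapX_pure tassocX_pure.
Qed.

Variables (f : {linear V -> W}) (f' : {linear W -> V}).
Hypotheses (fK : cancel f f') (fK' : cancel f' f).
Variable Dl : {linear V -> V ** V}.

Definition transport_cop : {linear W -> W ** W} := (f <**> f) \o Dl \o f'.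

Lemma tmap_fK t : (f' <**> f') ((f <**> f) t) = t.
Proof.
by rewrite tmapX_comp -[RHS]tmapX_id; apply: eq_tmapX => x; exact: fK.
Qed.

Lemma transport_copA :
  (forall x, tassocX X V V V ((Dl <**> idfun) (Dl x)) = (idfun <**> Dl) (Dl x)) ->
  forall y, tassocX X W W W ((transport_cop <**> idfun) (transport_cop y)) =
    (idfun <**> transport_cop) (transport_cop y).
Proof.
move=> DA y; set x := f' y.
have E1 : (transport_cop <**> idfun) (transport_cop y) =
    ((f <**> f) <**> f) ((Dl <**> idfun) (Dl x)).
  rewrite tmapX_comp [LHS]tmapX_comp; apply: eq_tmapX => z //=.
  by rewrite fK.
have E2 : (idfun <**> transport_cop) (transport_cop y) =
    (f <**> (f <**> f)) ((idfun <**> Dl) (Dl x)).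
  rewrite tmapX_comp [LHS]tmapX_comp; apply: eq_tmapX => z //=.
  by rewrite fK.
by rewrite E1 E2 tassocX_map DA.
Qed.

(** Representatives in W of the transported coproducts are taken back to V by f',
    where the two coproducts can be multiplied. *)
Lemma transport_copM (mu : {linear V ** V -> V})
    (A B : {malg K[(W * W)%type]}) x y :
  lext (fun p => p.1 <*> p.2) A = (f <**> f) (Dl x) ->
  lext (fun p => p.1 <*> p.2) B = (f <**> f) (Dl y) ->
  (f <**> f) ((mu <**> mu) (midswap X V V V V (Dl x <*> Dl y))) =
  lext (fun p => lext (fun q => f (mu (f' p.1 <*> f' q.1)) <*>
    f (mu (f' p.2 <*> f' q.2))) B) A.
Proof.
move=> AE BE.
have -> : Dl x = lext (fun p => f' p.1 <*> f' p.2) A.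
  by rewrite -[LHS]tmap_fK -AE; exact: (tmapX_lext idfun).
have -> : Dl y = lext (fun p => f' p.1 <*> f' p.2) B.
  by rewrite -[LHS]tmap_fK -BE; exact: (tmapX_lext idfun).
pose F : {linear V ** V ** (V ** V) -> W ** W} :=
  (f <**> f) \o (mu <**> mu) \o midswap X V V V V.
rewrite -[LHS]/(F _) lext_tpure; apply: eq_lext => p _; apply: eq_lext => q _.
rewrite -[LHS]/((f <**> f) ((mu <**> mu) (midswap X V V V V _))).
by rewrite midswap_pure !tmapX_pure.
Qed.

Lemma transport_mul (mu : {linear V ** V -> V}) (k l : {linear V -> V})
    (A : {malg K[(W * W)%type]}) t :
  lext (fun p => p.1 <*> p.2) A = (f <**> f) t ->
  lext (fun p => f (mu (k (f' p.1) <*> l (f' p.2)))) A = f (mu ((k <**> l) t)).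
Proof.
move=> E; rewrite -[t in RHS]tmap_fK -E tmapX_comp.
exact: esym (tmapX_lext (f \o mu) (k \o f') (l \o f') A).
Qed.

End TransportCoproduct.

Section Transport.
Variables (K : fieldType) (V W : lmodType K) (h : hopf_ops V).
Local Notation TP := (tensor_product K).
Local Notation "u <*> v" := (tpure TP u v) (at level 40, left associativity).
Local Notation "f <**> g" := (tmapX TP f g) (at level 40, left associativity).
Local Notation T := (ltop h).
Local Notation e := (lone h).
Hypothesis hh : is_locality_hopf h.
Variable mu : {linear tprod TP V V -> V}.
Hypothesis muE : forall a b, T a b -> mu (a <*> b) = lmul h a b.
Hypothesis hb : locality_bialgebra_model (X := TP) T mu e (lcop h) (lcounit h).
Variables (f : {linear V -> W}) (f' : {linear W -> V}).
Hypotheses (fK : cancel f f') (fK' : cancel f' f).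
Variables (topW : rel W) (mulW : W -> W -> W) (oneW : W).
Hypothesis topE : forall u v, topW u v = T (f' u) (f' v).
Hypothesis mulE : forall u v, topW u v -> f' (mulW u v) = lmul h (f' u) (f' v).
Hypothesis oneE : f' oneW = e.

(** The product mulW is given and not transported: off the related pairs it may
    differ from the transported one. *)
Definition transport_hopf : hopf_ops W :=
  HopfOps topW mulW oneW (transport_cop (X := TP) f f' (lcop h))
    (lcounit h \o f' : {linear W -> K^o}) (f \o lantip h \o f' : {linear W -> W}).

Lemma polarW U y : polar topW U y <-> polar T [set f' u | u in U] (f' y).
Proof.
split=> [Uy _ [u Uu <-]|Uy u Uu]; first by rewrite -topE; exact: Uy.
by rewrite topE; apply: Uy; exists u.
Qed.

Lemma mulWE u v : topW u v -> mulW u v = f (mu (f' u <*> f' v)).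
Proof. by move=> uv; rewrite muE -?topE // -mulE // fK'. Qed.

Lemma transport_space : locality_space topW.
Proof.
split=> [u v||U]; first by rewrite !topE (lb_sym hb).
  by rewrite topE linear0; have [] := alg_space (bialg_alg (hopf_bialg hh)).
have sU := lb_polar hb [set f' u | u in U].
split=> [|c x y /polarW Ux /polarW Uy]; apply/polarW.
  by rewrite linear0; exact: subspace0.
by rewrite linearP; exact: sU.2.
Qed.

Lemma lext_mulW (k l : {linear V -> V}) (A : {malg K[(W * W)%type]}) t :
  tclass A = (f <**> f) t ->
  lext (fun p => f (mu (k (f' p.1) <*> l (f' p.2)))) A =
  f (mu ((k <**> l) t)).
Proof.
by move=> At; apply: (transport_mul fK); rewrite -At; exact: esym (tclass_lext A).
Qed.

Lemma transport_indep U y : polar topW U y -> indep_tensor (X := TP) topW U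
  (transport_cop (X := TP) f f' (lcop h) y).
Proof.
move=> /polarW Uy.
apply: span_image (lb_cop_top hb Uy) => [|_ [a [b [Ua Ub Tab ->]]]].
  exact: span_subspace.
rewrite tmapX_pure; apply: span_incl; exists (f a), (f b); split=> //.
- by apply/polarW; rewrite fK.
- by apply/polarW; rewrite fK.
by rewrite topE !fK.
Qed.

Lemma transport_algebra : is_locality_algebra topW mulW oneW.
Proof.
have A := bialg_alg (hopf_bialg hh).
split.
- exact: transport_space.
- move=> X XT X0; have tX : tclass X = (f <**> f) 0.
    by rewrite linear0; apply/vproj_eq0.
  have -> : lext (fun p => mulW p.1 p.2) X =
      lext (fun p => f (mu (idfun (f' p.1) <*> idfun (f' p.2)))) X.
    by apply: eq_lext => p pX; rewrite mulWE //; exact: XT.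
  by rewrite (lext_mulW idfun idfun tX) !linear0.
- move=> a b c ab ac bc ab_c a_bc; apply: (can_inj fK').
  rewrite (mulE ab_c) (mulE ab) (mulE a_bc) (mulE bc).
  apply: (alg_assoc A); rewrite -?(mulE ab) -?(mulE bc) -topE //.
- move=> U a b /polarW Ua /polarW Ub ab; apply/polarW; rewrite mulE //.
  by apply: alg_polar A _ _ _ Ua Ub _; rewrite -topE.
- by move=> c a; rewrite topE linearZ_LR /= oneE; exact: alg_unit_polar A c _.
- move=> c a; apply: (can_inj fK'); rewrite mulE ?linearZ_LR /= ?oneE.
    exact: alg_unitl A c _.
  by rewrite topE linearZ_LR /= oneE; exact: alg_unit_polar A c _.
move=> c a; apply: (can_inj fK'); rewrite mulE ?linearZ_LR /= ?oneE.
  exact: alg_unitr A c _.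
by rewrite topE linearZ_LR /= oneE (lb_sym hb); exact: alg_unit_polar A c _.
Qed.

Local Notation Dl' := (transport_cop (X := TP) f f' (lcop h)).

Lemma transport_coalgebra :
  is_locality_coalgebra topW (lcop transport_hopf) (lcounit transport_hopf).
Proof.
split.
- exact: transport_space.
- move=> x; apply: span_mono (transport_indep (polar0 topW x)).
  by move=> _ [a [b [_ _ ab ->]]]; exists a, b.
- by move=> y; exact: (transport_copA fK (lb_copA hb) y).
- exact: transport_indep.
- move=> x; pose g : {linear tprod TP W W -> W} :=
    tfactor TP (bilinear_counitl (lcounit transport_hopf)).
  apply: (can_inj fK'); apply: (lb_counitl hb (f := f' \o g \o (f <**> f))) => a b.
  rewrite -[LHS]/(f' (g ((f <**> f) (a <*> b)))) tmapX_pure tfactor_pure.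
  by rewrite linearZ_LR /= !fK.
move=> x; have bl : bilinear_map (fun a b : W => (lcounit transport_hopf b : K) *: a).
  split=> [v|u] c a b /=; first by rewrite scalerDr !scalerA mulrC.
  by rewrite !linearP scalerDl scalerA.
pose g : {linear tprod TP W W -> W} := tfactor TP bl.
apply: (can_inj fK'); apply: (lb_counitr hb (f := f' \o g \o (f <**> f))) => a b.
rewrite -[LHS]/(f' (g ((f <**> f) (a <*> b)))) tmapX_pure tfactor_pure.
by rewrite linearZ_LR /= !fK.
Qed.

Lemma transport_bialgebra : is_locality_bialgebra transport_hopf.
Proof.
split.
- exact: transport_algebra.
- exact: transport_coalgebra.
- move=> x y X Y xy XT YT XY XE YE.
  have xy' : T (f' x) (f' y) by rewrite -topE.
  transitivity ((f <**> f) (lcop h (lmul h (f' x) (f' y)))).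
    by rewrite -[LHS]/((f <**> f) (lcop h (f' (mulW x y)))) (mulE xy).
  rewrite -(muE xy') (lb_copM hb xy').
  have XE' := etrans (esym (tclass_lext X)) XE.
  have YE' := etrans (esym (tclass_lext Y)) YE.
  apply: etrans (transport_copM fK mu XE' YE') _.
  apply: eq_lext => p pX; apply: eq_lext => q qY.
  have [T1 _ _ T4] := XY p q pX qY.
  by rewrite -(mulWE T1) -(mulWE T4).
- move=> x y xy; rewrite /= (mulE xy).
  by apply: (bialg_counitM (hopf_bialg hh)); rewrite -topE.
- rewrite -[LHS]/((f <**> f) (lcop h (f' oneW))) oneE (lb_cop1 hb) tmapX_pure.
  by rewrite -oneE fK'.
by rewrite /= oneE (lb_eps1 hb).
Qed.

Lemma transport_is_hopf : is_locality_hopf transport_hopf.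
Proof.
have antT x y : topW x y -> T (lantip h (f' x)) (f' y).
  by rewrite topE; exact: (hopf_antip_independent hh).
split.
- exact: transport_bialgebra.
- by move=> x y; rewrite /= !topE !fK; exact: (hopf_antip_locality hh).
- by move=> x y /antT; rewrite /= topE fK.
- move=> x X XT XE; apply: (can_inj fK').
  have -> : lext (fun p => lmul transport_hopf (lantip transport_hopf p.1) p.2) X =
      lext (fun p => f (mu (lantip h (f' p.1) <*> idfun (f' p.2)))) X.
    apply: eq_lext => p pX; rewrite [LHS]mulWE /= ?fK //.
    by rewrite topE fK; apply: antT; exact: XT.
  rewrite (lext_mulW (lantip h) idfun XE) fK linearZ_LR /= oneE.
  exact: antip_mull hh mu muE (f' x).
move=> x X XT XE; apply: (can_inj fK').
have -> : lext (fun p => lmul transport_hopf p.1 (lantip transport_hopf p.2)) X =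
    lext (fun p => f (mu (idfun (f' p.1) <*> lantip h (f' p.2)))) X.
  apply: eq_lext => p pX; rewrite [LHS]mulWE /= ?fK //.
  rewrite topE fK (lb_sym hb); apply: antT.
  by rewrite topE (lb_sym hb) -topE; exact: XT.
rewrite (lext_mulW idfun (lantip h) XE) fK linearZ_LR /= oneE.
exact: antip_mulr hh mu muE (f' x).
Qed.

Lemma transport_isomorphic : hopf_isomorphic h transport_hopf.
Proof.
exists f, f'; split; [exact: fK | exact: fK' | split | split].
- by move=> x y; rewrite /= topE !fK.
- move=> x y xy; have xy' : topW (f x) (f y) by rewrite topE !fK.
  by apply: (can_inj fK'); rewrite [RHS](mulE xy') !fK.
- by rewrite -[RHS]fK' [f' _]oneE.
- by move=> x; rewrite -[RHS]/((f <**> f) (lcop h (f' (f x)))) fK.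
- by move=> x; rewrite /= fK.
- by move=> x; rewrite /= fK.
- by move=> x y; rewrite /= topE.
- by move=> x y; exact: mulE.
- exact: oneE.
- by move=> x; exact: (tmap_fK (X := TP) fK (lcop h (f' x))).
- by [].
by move=> x; rewrite /= fK.
Qed.

End Transport.

(** * The structure theorem *)

Lemma natr_neq0 (R : realType) (K : fieldType) : real_or_complex R K ->
  forall n, n.+1%:R != 0 :> K.
Proof. by case=> n; rewrite Num.Theory.pnatr_eq0. Qed.

Theorem theorem9p5 (R : realType) (K : fieldType) (hK : real_or_complex R K)
    (H : lmodType K) (h : hopf_ops H) (hH : is_locality_hopf h)
    (G : nat -> set H) (hG : is_hopf_grading h G) (hconn : connected_grading G)
    (hcocomm : cocommutative h) :
  generated_by_primitives h /\
  let T := prim_top h in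
  let br := prim_bracket h in
  ((forall n, locality_compatible (Fword T n) (word_top T) (Imult_local T n)) ->
   locality_compatible setT (tens_top T) (Jideal T br) ->
   exists D eps S, is_envelope_hopf T br D eps S /\
                   hopf_isomorphic h (env_ops T br D eps S)).
Proof.
have natK := natr_neq0 hK.
have [mu muE] := locality_product hH.
have hb := locality_hopf_model hH muE hcocomm.
have Gsum := grading_sum hG.
have G0 x : G 0%N x -> exists c : K, x = c *: lone h.
  have [e0 [_ e0G]] := hconn; move=> /e0G [c ->].
  have [d eE] := (e0G _).1 (grading_one hG).
  have d0 : d != 0.
    apply/eqP => d0; have := lb_eps1 hb; rewrite eE d0 scale0r linear0.
    by move/eqP; rewrite eq_sym oner_eq0.
  by exists (c / d); rewrite eE scalerA divfK.
have Gcop n x : G n x -> span [set t | exists p q a b,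
    [/\ (p + q = n)%N, G p a, G q b & t = tpure (tensor_product K) a b]] (lcop h x).
  move=> Gx; apply: (span_min (span_subspace _)) (grading_cop hG Gx).
  move=> t [p [q [pq]]]; apply: span_mono => _ [a [b [Ga Gb _ ->]]].
  by exists p, q, a, b.
split.
  apply/seteqP; split=> // x _ B [sB Be BM] SB.
  refine (@euler1_generates _ _ _ _ _ _ _ _ hb natK _ Gsum G0 Gcop _ sB Be _ _ x).
    by move=> a b Ba Bb ab; rewrite muE //; exact: BM.
  move=> y; apply: SB; left; rewrite /= unfold_in; apply/eqP.
  exact: (euler1_primitive hb natK Gsum G0 Gcop y).
move=> T br _ _.
pose iota : {linear prim h -> H} := HB.pack (@prim_val K H h)
  (GRing.isLinear.Build K (prim h) H *:%R (@prim_val K H h) (fun c x y => erefl)).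
have iota_inj : injective iota := val_inj.
have iota_prim a : lcop h (iota a) = tens (iota a) (lone h) + tens (lone h) (iota a).
  by case: a => a; rewrite /= unfold_in => /eqP.
have prim_iota x : lcop h x = tens x (lone h) + tens (lone h) x -> exists a, iota a = x.
  by move=> /eqP xP; exists (Prim (xP : x \in primitive h)).
have brE a b : ltop h (iota a) (iota b) -> iota (br a b) =
    mu (tpure (tensor_product K) (iota a) (iota b)) -
    mu (tpure (tensor_product K) (iota b) (iota a)).
  move=> ab.
  have ba' : ltop h (iota b) (iota a) by rewrite (lb_sym hb).
  by rewrite (muE _ _ ab) (muE _ _ ba'); exact: prim_bracketE hH ab.
pose F : {linear H -> envelope T br} :=
  Phi_map hb natK Gsum G0 Gcop br iota_inj prim_iota.
pose F' : {linear envelope T br -> H} := psi (iota := iota) (br := br) hb brE.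
have FK : cancel F F' := Phi_psi hb natK Gsum G0 Gcop iota_inj prim_iota brE.
have FK' : cancel F' F := psi_Phi hb natK Gsum G0 Gcop iota_inj iota_prim prim_iota brE.
have topE u v : env_top u v = ltop h (F' u) (F' v).
  apply/idP/idP; first exact: (psi_top hb brE).
  move=> uv; have := Phi_top hb natK Gsum G0 Gcop br iota_inj prim_iota uv.
  by rewrite -![Phi _ _ _ _ _ _ _ _ _]/(F _) !FK'.
have mulE u v : env_top u v -> F' (env_mul u v) = lmul h (F' u) (F' v).
  by move=> uv; rewrite -muE -?topE //; exact: (psi_mul hb brE).
have oneE : F' (env_one T br) = lone h := psi_one hb brE.
have FiotaE a : F (iota a) = env_iota T br a.
  have E : F' (env_iota T br a) = iota a := psi_iota hb brE a.
  by rewrite -E FK'.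
have FoneE : F (lone h) = env_one T br by rewrite -oneE FK'.
pose hU := transport_hopf h F F' (@env_top K _ T br) (@env_mul K _ T br) (env_one T br).
exists (lcop hU), (lcounit hU), (lantip hU); split; last first.
  exact: (transport_isomorphic FK FK' topE mulE oneE).
split.
- exact: (transport_is_hopf hH muE hb FK FK' topE mulE oneE).
- move=> x; rewrite -[LHS]/(tmapX (tensor_product K) F F (lcop h (F' (env_iota T br x)))).
  rewrite -FiotaE FK iota_prim linearD.
  by rewrite !tmapX_pure FiotaE FoneE.
- move=> x; rewrite -[LHS]/(lcounit h (F' (env_iota T br x))) -FiotaE FK.
  exact: (counit_primitive hb (iota_prim x)).
move=> x; rewrite -[LHS]/(F (lantip h (F' (env_iota T br x)))) -FiotaE FK.
by rewrite (antip_primitive hH muE hcocomm (iota_prim x)) linearN.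
Qed.
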